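(* Let $H$ be a Hilbert module over a $C^*$-algebra. For every projection $P\in\mathcal{L}(H)$ and every idempotent $Q\in\mathcal{L}(H)$ with matched projection $m(Q)$, we have $$\|m(Q)-Q\|\leq 2\|P-Q\|.$$ If furthermore $(P,Q)$ is a quasi-projection pair, then $\|m(Q)-Q\|\leq \|P-Q\|$.
   Context: $\mathcal{L}(H)$ is the $C^*$-algebra of adjointable operators on the Hilbert $C^*$-module $H$, and $I$ is the identity operator on $H$. $\mathcal{R}(\cdot)$ and $\mathcal{N}(\cdot)$ denote range and null space. An idempotent is $Q\in\mathcal{L}(H)$ with $Q^2=Q$; a projection is a self-adjoint idempotent. $P_{\mathcal{R}(Q)}$ is the projection of $H$ onto the (orthogonally complemented) range of $Q$. An ordered pair $(P,Q)$, with $P\in\mathcal{L}(H)$ a projection and $Q\in\mathcal{L}(H)$ an idempotent, is called a quasi-projection pair if $PQ^*P=PQP$, $PQ^*(I-P)=-PQ(I-P)$, and $(I-P)Q^*(I-P)=(I-P)Q(I-P)$. Definition of the matched projection $m(Q)$ of an idempotent $Q\in\mathcal{L}(H)$: if $Q$ is a projection, $m(Q)=Q$. Otherwise, $H=\mathcal{R}(Q)\dotplus\mathcal{N}(Q^* )$ is an orthogonal decomposition; let $U:H\to\mathcal{R}(Q)\oplus\mathcal{N}(Q^* )$ be the unitary $Uh=\binom{P_{\mathcal{R}(Q)}h}{(I-P_{\mathcal{R}(Q)})h}$, let $I_1$ be the identity on $\mathcal{R}(Q)$, let $A=(Q-P_{\mathcal{R}(Q)})|_{\mathcal{N}(Q^*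 )}:\mathcal{N}(Q^* )\to\mathcal{R}(Q)$ and $B=(AA^*+I_1)^{1/2}$, and set $$m(Q)=U^*\cdot\frac12\begin{pmatrix}(B+I_1)B^{-1} & B^{-1}A\\ A^*B^{-1} & A^*[B(B+I_1)]^{-1}A\end{pmatrix}\cdot U .$$ *)

(* Defs.v *)
From HB Require Import structures.
From mathcomp Require Import all_boot all_order all_algebra.
From mathcomp Require Import all_classical all_reals all_analysis.
From mathcomp Require Import complex.

Set Implicit Arguments.
Unset Strict Implicit.
Unset Printing Implicit Defensive.

Import Order.TTheory GRing.Theory Num.Theory numFieldNormedType.Exports.

Local Open Scope classical_set_scope.
Local Open Scope ring_scope.

(* C*-algebras over the complex numbers R[i]; no unit is assumed, so the
   product cannot come from the ring structures of the library. *)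
HB.mixin Record isCStarAlgebra (R : realType) A
    of CompleteNormedModule R[i] A := {
  cmul : A -> A -> A;
  cstar : A -> A;
  cmulA : associative cmul;
  cmulDl : left_distributive cmul +%R;
  cmulDr : right_distributive cmul +%R;
  cmulZl : forall (k : R[i]) a b, cmul (k *: a) b = k *: cmul a b;
  cmulZr : forall (k : R[i]) a b, cmul a (k *: b) = k *: cmul a b;
  cstarK : involutive cstar;
  cstarD : {morph cstar : a b / a + b};
  cstarZ : forall (k : R[i]) a, cstar (k *: a) = conjc k *: cstar a;
  cstarM : forall a b, cstar (cmul a b) = cmul (cstar b) (cstar a);
  norm_cmul : forall a b, `|cmul a b| <= `|a| * `|b|;
  norm_cstar_mul : forall a, `|cmul (cstar a) a| = `|a| ^+ 2
}.

#[short(type="cstarAlgType")]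
HB.structure Definition CStarAlgebra (R : realType) :=
  {A of isCStarAlgebra R A & CompleteNormedModule R[i] A}.

Definition cpositive (R : realType) (A : cstarAlgType R) (a : A) : Prop :=
  exists b : A, a = cmul (cstar b) b.

(* Right inner-product A-modules; the inner product is A-linear in its second
   argument. *)
HB.mixin Record isInnerProductModule (R : realType) (A : cstarAlgType R) E
    of GRing.Lmodule R[i] E := {
  ract : E -> A -> E;
  inner : E -> E -> A;
  ractDl : forall x y a, ract (x + y) a = ract x a + ract y a;
  ractDr : forall x a b, ract x (a + b) = ract x a + ract x b;
  ractZl : forall (k : R[i]) x a, ract (k *: x) a = k *: ract x a;
  ractZr : forall (k : R[i]) x a, ract x (k *: a) = k *: ract x a;
  ractA : forall x a b, ract x (cmul a b) = ract (ract x a) b;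
  innerDr : forall x y z, inner x (y + z) = inner x y + inner x z;
  innerZr : forall (k : R[i]) x y, inner x (k *: y) = k *: inner x y;
  inner_ract : forall x y a, inner x (ract y a) = cmul (inner x y) a;
  cstar_inner : forall x y, cstar (inner x y) = inner y x;
  inner_ge0 : forall x, cpositive (inner x x);
  inner_eq0 : forall x, inner x x = 0 -> x = 0
}.

#[short(type="innerProductModType")]
HB.structure Definition InnerProductModule (R : realType)
    (A : cstarAlgType R) :=
  {E of isInnerProductModule R A E & GRing.Lmodule R[i] E}.

(* Hilbert modules: complete for the norm |x| = |<x, x>|^(1/2). *)
HB.mixin Record InnerProduct_isHilbertModule (R : realType)
    (A : cstarAlgType R) H
    of InnerProductModule R A H & CompleteNormedModule R[i] H := {
  sqr_norm_inner : forall x : H, `|x| ^+ 2 = `|inner x x : A|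
}.

#[short(type="hilbertModType")]
HB.structure Definition HilbertModule (R : realType) (A : cstarAlgType R) :=
  {H of InnerProduct_isHilbertModule R A H & InnerProductModule R A H
      & CompleteNormedModule R[i] H}.

Section InnerTheory.
Context {R : realType} {A : cstarAlgType R} {E : innerProductModType A}.
Implicit Types x y z : E.

Lemma cstar0 : cstar (0 : A) = 0.
Proof. by apply: (addrI (cstar 0)); rewrite -cstarD !addr0. Qed.

Lemma inner0r x : inner x 0 = 0 :> A.
Proof. by rewrite -(scale0r (0 : E)) innerZr scale0r. Qed.

Lemma innerDl x y z : inner (x + y) z = inner x z + inner y z :> A.
Proof. by rewrite -cstar_inner innerDr cstarD !cstar_inner. Qed.

Lemma innerZl (k : R[i]) x y : inner (k *: x) y = conjc k *: inner x y :> A.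
Proof. by rewrite -cstar_inner innerZr cstarZ cstar_inner. Qed.

Lemma inner0l x : inner 0 x = 0 :> A.
Proof. by rewrite -cstar_inner inner0r cstar0. Qed.

Lemma innerNr x y : inner x (- y) = - inner x y :> A.
Proof. by rewrite -scaleN1r innerZr scaleN1r. Qed.

Lemma innerNl x y : inner (- x) y = - inner x y :> A.
Proof. by rewrite -scaleN1r innerZl rmorphN rmorph1 scaleN1r. Qed.

Lemma inner_ractl x y (a : A) : inner (ract x a) y = cmul (cstar a) (inner x y).
Proof. by rewrite -cstar_inner inner_ract cstarM cstar_inner. Qed.

Lemma inner_injl x y : (forall z, inner x z = inner y z :> A) -> x = y.
Proof.
move=> xy; apply/eqP; rewrite -subr_eq0; apply/eqP/(@inner_eq0 _ A).
by rewrite innerDl innerNl xy subrr.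
Qed.

Lemma inner_injr x y : (forall z, inner z x = inner z y :> A) -> x = y.
Proof.
by move=> xy; apply: inner_injl => z; rewrite -cstar_inner xy cstar_inner.
Qed.

End InnerTheory.

(* Adjointable operators, bundled with their (unique) adjoint. *)
Record adjointable (R : realType) (A : cstarAlgType R)
    (E F : innerProductModType A) := Adjointable {
  opfun :> E -> F;
  opadj : F -> E;
  opadjP : forall x y, inner (opfun x) y = inner x (opadj y) :> A
}.

Notation "''L' ( E , F )" := (adjointable E F)
  (at level 8, format "''L' ( E ,  F )") : type_scope.
Notation "''L' ( E )" := (adjointable E E)
  (at level 8, format "''L' ( E )") : type_scope.

HB.instance Definition _ (R : realType) (A : cstarAlgType R)
  (E F : innerProductModType A) := gen_eqMixin 'L(E, F).
HB.instance Definition _ (R : realType) (A : cstarAlgType R)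
  (E F : innerProductModType A) := gen_choiceMixin 'L(E, F).

Section Adjointable.
Context {R : realType} {A : cstarAlgType R}.
Implicit Types E F G : innerProductModType A.

Lemma adjointable_ext E F (S T : 'L(E, F)) : S =1 T -> S = T.
Proof.
case: S T => [f f' fP] [g g' gP] /= fg.
have {}fg : f = g by apply/funext.
subst g; have fg' : f' = g'.
  by apply/funext => y; apply: inner_injr => z; rewrite -fP gP.
by subst g'; congr Adjointable; apply: Prop_irrelevance.
Qed.

Lemma opadjP' E F (T : 'L(E, F)) y x :
  inner (opadj T y) x = inner y (T x) :> A.
Proof. by rewrite -cstar_inner -opadjP cstar_inner. Qed.

Definition adjoint E F (T : 'L(E, F)) : 'L(F, E) := Adjointable (opadjP' T).

Lemma opfunD E F (T : 'L(E, F)) x y : T (x + y) = T x + T y.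
Proof. by apply: inner_injl => z; rewrite innerDl !opadjP innerDl. Qed.

Lemma opfunZ E F (T : 'L(E, F)) (k : R[i]) x : T (k *: x) = k *: T x.
Proof. by apply: inner_injl => z; rewrite innerZl !opadjP innerZl. Qed.

Lemma opfun0 E F (T : 'L(E, F)) : T 0 = 0.
Proof. by rewrite -(scale0r (0 : E)) opfunZ scale0r. Qed.

Lemma opfun_ract E F (T : 'L(E, F)) x (a : A) : T (ract x a) = ract (T x) a.
Proof.
by apply: inner_injl => z; rewrite inner_ractl !opadjP inner_ractl.
Qed.

Lemma op_zero_subproof E F x y :
  inner ((fun _ : E => 0 : F) x) y = inner x ((fun _ : F => 0 : E) y) :> A.
Proof. by rewrite inner0l inner0r. Qed.
Definition op_zero E F : 'L(E, F) := Adjointable (@op_zero_subproof E F).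

Lemma op_add_subproof E F (S T : 'L(E, F)) x y :
  inner (S x + T x) y = inner x (opadj S y + opadj T y) :> A.
Proof. by rewrite innerDl innerDr !opadjP. Qed.
Definition op_add E F (S T : 'L(E, F)) : 'L(E, F) :=
  @Adjointable _ _ _ _ (fun x => S x + T x) _ (op_add_subproof S T).

Lemma op_scale_subproof E F (k : R[i]) (T : 'L(E, F)) x y :
  inner (k *: T x) y = inner x (conjc k *: opadj T y) :> A.
Proof. by rewrite innerZl innerZr opadjP. Qed.
Definition op_scale E F (k : R[i]) (T : 'L(E, F)) : 'L(E, F) :=
  @Adjointable _ _ _ _ (fun x => k *: T x) _ (op_scale_subproof k T).

Lemma op_opp_subproof E F (T : 'L(E, F)) x y :
  inner (- T x) y = inner x (- opadj T y) :> A.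
Proof. by rewrite innerNl innerNr opadjP. Qed.
Definition op_opp E F (T : 'L(E, F)) : 'L(E, F) :=
  @Adjointable _ _ _ _ (fun x => - T x) _ (op_opp_subproof T).

Lemma op_comp_subproof E F G (S : 'L(F, G)) (T : 'L(E, F)) x y :
  inner (S (T x)) y = inner x (opadj T (opadj S y)) :> A.
Proof. by rewrite !opadjP. Qed.
Definition op_comp E F G (S : 'L(F, G)) (T : 'L(E, F)) : 'L(E, G) :=
  @Adjointable _ _ _ _ (fun x => S (T x)) _ (op_comp_subproof S T).

Lemma op_id_subproof E (x y : E) : inner (idfun x) y = inner x (idfun y) :> A.
Proof. by []. Qed.
Definition op_id E : 'L(E) := Adjointable (@op_id_subproof E).

End Adjointable.

Notation "S '\oA' T" := (op_comp S T)
  (at level 40, left associativity, format "S  \oA  T") : ring_scope.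

Section AdjointableModule.
Context {R : realType} {A : cstarAlgType R} {E F : innerProductModType A}.
Implicit Types S T U : 'L(E, F).

Lemma op_addA : associative (@op_add R A E F).
Proof. by move=> S T U; apply: adjointable_ext => x /=; rewrite addrA. Qed.
Lemma op_addC : commutative (@op_add R A E F).
Proof. by move=> S T; apply: adjointable_ext => x /=; rewrite addrC. Qed.
Lemma op_add0 : left_id (@op_zero R A E F) (@op_add R A E F).
Proof. by move=> T; apply: adjointable_ext => x /=; rewrite add0r. Qed.
Lemma op_addN : left_inverse (@op_zero R A E F) (@op_opp R A E F)
  (@op_add R A E F).
Proof. by move=> T; apply: adjointable_ext => x /=; rewrite addNr. Qed.

HB.instance Definition _ :=
  GRing.isZmodule.Build 'L(E, F) op_addA op_addC op_add0 op_addN.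

Lemma op_scaleA (k l : R[i]) T : op_scale k (op_scale l T) = op_scale (k * l) T.
Proof. by apply: adjointable_ext => x /=; rewrite scalerA. Qed.
Lemma op_scale1 : left_id 1 (@op_scale R A E F).
Proof. by move=> T; apply: adjointable_ext => x /=; rewrite scale1r. Qed.
Lemma op_scaleDr : right_distributive (@op_scale R A E F) +%R.
Proof. by move=> k S T; apply: adjointable_ext => x /=; rewrite scalerDr. Qed.
Lemma op_scaleDl T : {morph (@op_scale R A E F)^~ T : k l / k + l}.
Proof. by move=> k l; apply: adjointable_ext => x /=; rewrite scalerDl. Qed.

HB.instance Definition _ :=
  GRing.Zmodule_isLmodule.Build R[i] 'L(E, F)
    op_scaleA op_scale1 op_scaleDr op_scaleDl.

End AdjointableModule.

Section AdjointableRing.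
Context {R : realType} {A : cstarAlgType R} {E : innerProductModType A}.

Lemma op_compA : associative (fun S T : 'L(E) => S \oA T).
Proof. by move=> S T U; apply: adjointable_ext. Qed.
Lemma op_comp1l : left_id (op_id E) (fun S T : 'L(E) => S \oA T).
Proof. by move=> T; apply: adjointable_ext. Qed.
Lemma op_comp1r : right_id (op_id E) (fun S T : 'L(E) => S \oA T).
Proof. by move=> T; apply: adjointable_ext. Qed.
Lemma op_compDl : left_distributive (fun S T : 'L(E) => S \oA T) +%R.
Proof. by move=> S T U; apply: adjointable_ext. Qed.
Lemma op_compDr : right_distributive (fun S T : 'L(E) => S \oA T) +%R.
Proof. by move=> S T U; apply: adjointable_ext => x /=; rewrite opfunD. Qed.

HB.instance Definition _ := GRing.Zmodule_isPzRing.Build 'L(E)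
  op_compA op_comp1l op_comp1r op_compDl op_compDr.

End AdjointableRing.

Record submodule (R : realType) (A : cstarAlgType R)
    (E : innerProductModType A) := Submodule {
  carrier : set E;
  carrier0 : carrier 0;
  carrierD : forall x y, carrier x -> carrier y -> carrier (x + y);
  carrierZ : forall (k : R[i]) x, carrier x -> carrier (k *: x);
  carrier_ract : forall x (a : A), carrier x -> carrier (ract x a)
}.

Section SubmoduleType.
Context {R : realType} {A : cstarAlgType R} {E : innerProductModType A}.
Variable V : submodule E.

Definition in_submodule : {pred E} := [pred x | `[< carrier V x >]].

Lemma in_submoduleP : submod_closed in_submodule.
Proof.
split; first exact/asboolP/carrier0.
move=> k x y /asboolP Vx /asboolP Vy; apply/asboolP.
exact/carrierD/Vy/carrierZ/Vx.
Qed.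

HB.instance Definition _ :=
  GRing.isSubmodClosed.Build R[i] E in_submodule in_submoduleP.

Record submodule_type := InSubmodule {
  inclusion : E;
  inclusionP : inclusion \in in_submodule
}.

HB.instance Definition _ := [isSub for inclusion].
HB.instance Definition _ := [Choice of submodule_type by <:].
HB.instance Definition _ := [SubChoice_isSubLmodule of submodule_type by <:].

Lemma sub_ract_subproof (x : submodule_type) (a : A) :
  ract (inclusion x) a \in in_submodule.
Proof. by apply/asboolP/carrier_ract/asboolP/(inclusionP x). Qed.

Definition sub_ract (x : submodule_type) (a : A) : submodule_type :=
  InSubmodule (sub_ract_subproof x a).
Definition sub_inner (x y : submodule_type) : A :=
  inner (inclusion x) (inclusion y).

Lemma sub_ractDl x y a : sub_ract (x + y) a = sub_ract x a + sub_ract y a.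
Proof. by apply: val_inj; rewrite /= ractDl. Qed.
Lemma sub_ractDr x a b : sub_ract x (a + b) = sub_ract x a + sub_ract x b.
Proof. by apply: val_inj; rewrite /= ractDr. Qed.
Lemma sub_ractZl (k : R[i]) x a : sub_ract (k *: x) a = k *: sub_ract x a.
Proof. by apply: val_inj; rewrite /= ractZl. Qed.
Lemma sub_ractZr (k : R[i]) x a : sub_ract x (k *: a) = k *: sub_ract x a.
Proof. by apply: val_inj; rewrite /= ractZr. Qed.
Lemma sub_ractA x a b : sub_ract x (cmul a b) = sub_ract (sub_ract x a) b.
Proof. by apply: val_inj; rewrite /= ractA. Qed.
Lemma sub_innerDr x y z : sub_inner x (y + z) = sub_inner x y + sub_inner x z.
Proof. by rewrite /sub_inner /= innerDr. Qed.
Lemma sub_innerZr (k : R[i]) x y : sub_inner x (k *: y) = k *: sub_inner x y.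
Proof. by rewrite /sub_inner /= innerZr. Qed.
Lemma sub_inner_ract x y a : sub_inner x (sub_ract y a) = cmul (sub_inner x y) a.
Proof. exact: inner_ract. Qed.
Lemma sub_cstar_inner x y : cstar (sub_inner x y) = sub_inner y x.
Proof. exact: cstar_inner. Qed.
Lemma sub_inner_ge0 x : cpositive (sub_inner x x).
Proof. exact: inner_ge0. Qed.
Lemma sub_inner_eq0 x : sub_inner x x = 0 -> x = 0.
Proof.
move=> /(@inner_eq0 _ A) x0; apply: val_inj => /=.
by rewrite x0 -[RHS](raddf0 (val : submodule_type -> E)).
Qed.

HB.instance Definition _ := isInnerProductModule.Build R A submodule_type
  sub_ractDl sub_ractDr sub_ractZl sub_ractZr sub_ractA sub_innerDr sub_innerZr
  sub_inner_ract sub_cstar_inner sub_inner_ge0 sub_inner_eq0.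

End SubmoduleType.

Coercion submodule_module (R : realType) (A : cstarAlgType R)
    (E : innerProductModType A) (V : submodule E) : innerProductModType A :=
  submodule_type V.

Section RangeKernel.
Context {R : realType} {A : cstarAlgType R} {E F : innerProductModType A}.
Variable T : 'L(E, F).

Let range_closed0 : range T 0. Proof. by exists 0; rewrite ?opfun0. Qed.
Let range_closedD x y : range T x -> range T y -> range T (x + y).
Proof. by move=> [u _ <-] [v _ <-]; exists (u + v); rewrite ?opfunD. Qed.
Let range_closedZ (k : R[i]) x : range T x -> range T (k *: x).
Proof. by move=> [u _ <-]; exists (k *: u); rewrite ?opfunZ. Qed.
Let range_closed_ract x (a : A) : range T x -> range T (ract x a).
Proof. by move=> [u _ <-]; exists (ract u a); rewrite ?opfun_ract. Qed.

Definition op_range : submodule F :=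
  Submodule range_closed0 range_closedD range_closedZ range_closed_ract.

Let ker_closed0 : [set x | T x = 0] 0. Proof. exact: opfun0. Qed.
Let ker_closedD x y : T x = 0 -> T y = 0 -> T (x + y) = 0.
Proof. by rewrite opfunD => -> ->; rewrite addr0. Qed.
Let ker_closedZ (k : R[i]) x : T x = 0 -> T (k *: x) = 0.
Proof. by rewrite opfunZ => ->; rewrite scaler0. Qed.
Let ker_closed_ract x (a : A) : T x = 0 -> T (ract x a) = 0.
Proof.
rewrite opfun_ract => ->.
by apply: (addrI (ract 0 a)); rewrite -ractDl !addr0.
Qed.

Definition op_kernel : submodule E :=
  @Submodule _ _ _ [set x | T x = 0]
    ker_closed0 ker_closedD ker_closedZ ker_closed_ract.

End RangeKernel.

Section OperatorNotions.
Context {R : realType} {A : cstarAlgType R}.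
Implicit Types E : innerProductModType A.

Definition is_idempotent E (Q : 'L(E)) : Prop := Q * Q = Q.

Definition is_projection E (P : 'L(E)) : Prop :=
  is_idempotent P /\ adjoint P = P.

Definition op_positive E (T : 'L(E)) : Prop :=
  exists S : 'L(E), T = adjoint S * S.

Definition quasi_projection_pair E (P Q : 'L(E)) : Prop :=
  [/\ is_projection P, is_idempotent Q,
      P * adjoint Q * P = P * Q * P,
      P * adjoint Q * (1 - P) = - (P * Q * (1 - P)) &
      (1 - P) * adjoint Q * (1 - P) = (1 - P) * Q * (1 - P)].

(* On a Hilbert module, each of the following operators is unique if it
   exists; the value 0 is used when it does not. *)
Definition op_sqrt E (T : 'L(E)) : 'L(E) :=
  xget 0 [set S | op_positive S /\ S * S = T].

Definition op_inv E (T : 'L(E)) : 'L(E) :=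
  xget 0 [set S | S * T = 1 /\ T * S = 1].

Definition range_projection E (Q : 'L(E)) : 'L(E) :=
  xget 0 [set P | is_projection P /\ range P = range Q].

(* The adjointable operator into the submodule V induced by a map f whose
   values lie in V. *)
Definition corestrict E' E (V : submodule E) (f : E' -> E) : 'L(E', V) :=
  xget 0 [set S : 'L(E', V) | forall x, inclusion (S x) = f x].

(* The norm of the library is R[i]-valued, hence the real part.  The supremum
   is taken in the extended reals. *)
Definition opnorm (H : hilbertModType A) (T : 'L(H)) : \bar R :=
  ereal_sup [set (complex.Re `|T x|)%:E | x in [set x : H | `|x| <= 1]].

End OperatorNotions.

Section MatchedProjection.
Context {R : realType} {A : cstarAlgType R} {H : innerProductModType A}.
Variable Q : 'L(H).

Local Notation RQ := (op_range Q).
Local Notation NQ := (op_kernel (adjoint Q)).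
Local Notation PQ := (range_projection Q).

(* The two components of the unitary U from H onto the direct sum of RQ
   and NQ. *)
Definition matchedU1 : 'L(H, RQ) := corestrict RQ (fun h : H => PQ h).
Definition matchedU2 : 'L(H, NQ) := corestrict NQ (fun h : H => (1 - PQ) h).

Definition matchedA : 'L(NQ, RQ) :=
  corestrict RQ (fun x : NQ => (Q - PQ) (inclusion x)).

Definition matchedB : 'L(RQ) := op_sqrt (matchedA \oA adjoint matchedA + 1).

(* U^* M U for the operator matrix M = [M11, M12; M21, M22]. *)
Definition matched_block (M11 : 'L(RQ)) (M12 : 'L(NQ, RQ)) (M21 : 'L(RQ, NQ))
    (M22 : 'L(NQ)) : 'L(H) :=
  adjoint matchedU1 \oA (M11 \oA matchedU1 + M12 \oA matchedU2) +
  adjoint matchedU2 \oA (M21 \oA matchedU1 + M22 \oA matchedU2).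

Definition matched_projection : 'L(H) :=
  if `[< is_projection Q >] then Q else
  2^-1 *: matched_block
    ((matchedB + 1) * op_inv matchedB)
    (op_inv matchedB \oA matchedA)
    (adjoint matchedA \oA op_inv matchedB)
    (adjoint matchedA \oA op_inv (matchedB * (matchedB + 1)) \oA matchedA).

End MatchedProjection.

(* Main.v *)
(* Write S = 2Q - 1, F = Q + Q* - 1 and M = (F^2)^(-1/2). Unwinding the block
   matrix gives 2 m(Q) - 1 = W with W = F M, the unitary polar part of S, and
   T = W S is positive with inverse S W. Hence 2 (m(Q) - Q) = W (1 - T). If
   c = 1 + 2 |P - Q|, then |T| and |T^-1| are at most |S| <= |2P - 1| + 2 |P - Q|
   <= c, so the spectrum of T lies in [1/c, c] and |1 - T| <= c - 1. This gives
   |m(Q) - Q| <= |P - Q| for every projection P, hence both claims.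

   The order of the C*-algebra A is avoided throughout: only the triangle
   inequality in H is used. Contractions are handled as averages of isometries
   K + iL and K - iL with K^2 + L^2 = 1, and positivity, where uniqueness of
   square roots needs it, is replaced by accretivity. *)
Require Import Defs.
From HB Require Import structures.
From mathcomp Require Import all_boot all_order all_algebra.
From mathcomp Require Import all_classical all_reals all_analysis.
From mathcomp Require Import complex ring lra.
From Stdlib Require Ncring Ncring_tac.

Set Implicit Arguments.
Unset Strict Implicit.
Unset Printing Implicit Defensive.

Import Order.TTheory GRing.Theory Num.Theory numFieldNormedType.Exports.

Local Open Scope classical_set_scope.
Local Open Scope complex_scope.
Local Open Scope ring_scope.

(** Positivity enters twice: in the bound on 1 - T, and in identifying [matchedB], which is
    specified only as a positive square root. The usable form of positivity is being the square of a
    self-adjoint operator. Hence (F^2)^(1/2) must itself be exhibited as a square, and a fourth root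
    of F^2 is carried along: this is what [S] denotes in the code, while the symmetry 2Q - 1 of the
    overview is called [V]. Square roots come from an iteration that contracts only for a norm bound
    below 1. The estimate of 1 - T is therefore proved for every d > c, and d decreases to c at the
    very end. The range of Q and the kernel of [adjoint Q] are available only as inner product
    modules, without norm or completeness. All analysis takes place on H and is transported to the
    range by compression. *)

#[local] Instance nc_ops (V : pzRingType) :
  @Ncring.Ring_ops V 0 1 +%R *%R (fun x y => x - y) -%R eq := {}.
#[local] Instance nc_ring (V : pzRingType) :
  @Ncring.Ring _ _ _ _ _ _ _ _ (nc_ops V).
Proof.
split; rewrite /Algebra_syntax.equality /Ncring.eq_notation //.
all: try exact _.
all: try by repeat move=> ? ? ->.
all: by move=> *; first [exact: add0r|exact: addrC|exact: addrA|exact: mul1r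
  |exact: mulr1|exact: mulrA|exact: mulrDl|exact: mulrDr|exact: subrr].
Qed.
(** Decides identities of the free noncommutative ring only. Relations such as Q Q = Q are applied
    by passing through an intermediate expression in which the squares are visible. *)
Ltac ncring := Ncring_tac.non_commutative_ring.

(** * Real-valued norms *)

Section RealNorm.
Context {R : realType}.

(** Norms are moved from [R[i]] to [R], where the order is total and [lra] applies. *)
Definition rnorm (V : normedModType R[i]) (x : V) : R := complex.Re `|x|.

Context {V : normedModType R[i]}.
Implicit Types x y z : V.

Lemma rnormE x : (rnorm x)%:C = `|x|.
Proof. by rewrite /rnorm RRe_real // ger0_real. Qed.

Lemma rnorm_ge0 x : 0 <= rnorm x.
Proof. by rewrite -ler0c rnormE. Qed.

Lemma rnormD x y : rnorm (x + y) <= rnorm x + rnorm y.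
Proof. by rewrite -lecR rmorphD /= !rnormE ler_normD. Qed.

Lemma rnormN x : rnorm (- x) = rnorm x.
Proof. by rewrite /rnorm normrN. Qed.

Lemma rnormB x y : rnorm (x - y) <= rnorm x + rnorm y.
Proof. by rewrite -(rnormN y) rnormD. Qed.

Lemma rnorm0 : rnorm (0 : V) = 0.
Proof. by rewrite /rnorm normr0. Qed.

Lemma rnorm_eq0 x : rnorm x = 0 -> x = 0.
Proof. by move=> x0; apply/normr0_eq0; rewrite -rnormE x0. Qed.

Lemma rnormZ_cplx (k : R[i]) x : rnorm (k *: x) = complex.Re `|k| * rnorm x.
Proof.
by rewrite /rnorm normrZ -(rnormE x) normc_def /= mulr0 subr0.
Qed.

Lemma rnormZ (k : R) x : rnorm (k%:C *: x) = `|k| * rnorm x.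
Proof. by rewrite rnormZ_cplx normc_def /= expr0n /= addr0 sqrtr_sqr. Qed.

Lemma rnormZi x : rnorm ('i%C *: x) = rnorm x.
Proof. by rewrite rnormZ_cplx normc_def /= expr0n /= add0r expr1n sqrtr1 mul1r. Qed.

Lemma rdist_triangle y x z : rnorm (x - z) <= rnorm (x - y) + rnorm (y - z).
Proof. by rewrite -{1}(subrK y x) -addrA rnormD. Qed.

Lemma rnormDD x : rnorm (x + x) = 2 * rnorm x.
Proof.
rewrite -[2]ger0_norm // -rnormZ; congr rnorm.
by rewrite -[2]/(1 + 1) rmorphD rmorph1 scalerDl scale1r.
Qed.

End RealNorm.

(** * Geometric convergence *)

Lemma expr_small {R : realType} (r e : R) : 0 <= r < 1 -> 0 < e ->
  exists n, r ^+ n < e.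
Proof.
move=> /andP[r0 r1] e0.
have : (GRing.exp r : nat -> R) @ \oo --> 0 by apply: cvg_expr; rewrite ger0_norm.
move=> /cvgrPdist_lt /(_ _ e0) [n _ /(_ n (leqnn n))] /=.
by rewrite sub0r normrN ger0_norm ?exprn_ge0 // => ?; exists n.
Qed.

Lemma geometric_le0 {R : realType} (r M d : R) : 0 <= r < 1 ->
  (forall n, d <= M * r ^+ n) -> d <= 0.
Proof.
move=> r01 dM; rewrite leNgt; apply/negP => d0.
have M0 : 0 < M by apply: lt_le_trans d0 _; have := dM 0; rewrite expr0 mulr1.
have [n] := expr_small r01 (divr_gt0 d0 M0).
by rewrite ltr_pdivlMr // mulrC ltNge dM.
Qed.

Lemma geometric_limit {R : realType} {V : completeNormedModType R[i]}
    (u : nat -> V) (r M : R) : 0 <= r < 1 -> 0 <= M ->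
  (forall n, rnorm (u n.+1 - u n) <= M * r ^+ n) ->
  exists l, forall n, rnorm (l - u n) <= M / (1 - r) * r ^+ n.
Proof.
move=> r01 M0 du; have /andP[r0 r1] := r01.
have r1' : 0 < 1 - r by lra.
set K := M / (1 - r).
have K0 : 0 <= K by rewrite divr_ge0 // ltW.
have MK : M = K * (1 - r) by rewrite /K divfK // gt_eqF.
(* Keeping the subtracted tail makes the induction on k telescope, because M = K (1 - r). *)
have dist n k : rnorm (u (n + k)%N - u n) <= K * r ^+ n - K * r ^+ (n + k).
  elim: k => [|k IH]; first by rewrite addn0 !subrr rnorm0.
  apply: le_trans (rdist_triangle (u (n + k)%N) _ _) _.
  have := du (n + k)%N; rewrite addnS exprS MK => h.
  by apply: le_trans (lerD h IH) _; lra.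
have dist' n k : rnorm (u (n + k)%N - u n) <= K * r ^+ n.
  by apply: le_trans (dist n k) _; rewrite gerBl mulr_ge0 // exprn_ge0.
have small (e : R) : 0 < e -> exists n, K * r ^+ n < e.
  move=> e0; have K1 : 0 < K + 1 by lra.
  have [n rn] := expr_small r01 (divr_gt0 e0 K1); exists n.
  rewrite ltr_pdivlMr // in rn; apply: le_lt_trans rn.
  by rewrite mulrC ler_wpM2l ?exprn_ge0 //; lra.
have : cvg (u @ \oo).
  apply/cauchy_cvgP/cauchy_exP => e e0.
  have eE : e = (complex.Re e)%:C by rewrite RRe_real // gtr0_real.
  have e0' : 0 < complex.Re e by rewrite -ltcR -eE.
  have [n Kn] := small _ e0'.
  exists (u n), n => // m /= nm; rewrite -(subnKC nm) -ball_normE /= distrC.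
  by rewrite -rnormE eE ltcR (le_lt_trans (dist' _ _)).
move=> /cvg_ex[l ul]; exists l => n; apply/ler_addgt0Pr => e e0.
have : 0 < e%:C :> R[i] by rewrite ltcR.
move/cvgrPdist_lt: ul => /[apply] -[N _ /(_ (n + N)%N)] /=.
rewrite leq_addl -rnormE ltcR => /(_ isT) ul.
apply: le_trans (rdist_triangle (u (n + N)%N) _ _) _.
by rewrite addrC lerD // ?dist' // ltW.
Qed.

(** * Bounded adjointable operators *)

Section OperatorAlgebra.
Context {R : realType} {A : cstarAlgType R} {E : innerProductModType A}.
Implicit Types S T : 'L(E).

Lemma adjointK S : adjoint (adjoint S) = S.
Proof. exact: adjointable_ext. Qed.

Lemma adjointD S T : adjoint (S + T) = adjoint S + adjoint T.
Proof. exact: adjointable_ext. Qed.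

Lemma adjointN S : adjoint (- S) = - adjoint S.
Proof. exact: adjointable_ext. Qed.

Lemma adjointB S T : adjoint (S - T) = adjoint S - adjoint T.
Proof. exact: adjointable_ext. Qed.

Lemma adjointM S T : adjoint (S * T) = adjoint T * adjoint S.
Proof. exact: adjointable_ext. Qed.

Lemma adjoint1 : adjoint (1 : 'L(E)) = 1.
Proof. exact: adjointable_ext. Qed.

Lemma adjointZ (k : R[i]) S : adjoint (k *: S) = conjc k *: adjoint S.
Proof. exact: adjointable_ext. Qed.

Lemma adjointZr (k : R) S : adjoint (k%:C *: S) = k%:C *: adjoint S.
Proof. by rewrite adjointZ conjc_real. Qed.

Lemma opscalerAl (k : R[i]) S T : k *: (S * T) = (k *: S) * T.
Proof. exact: adjointable_ext. Qed.

Lemma opscalerAr (k : R[i]) S T : k *: (S * T) = S * (k *: T).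
Proof. by apply: adjointable_ext => x /=; rewrite opfunZ. Qed.

Lemma opscalerM (k l : R[i]) S T : (k *: S) * (l *: T) = (k * l) *: (S * T).
Proof. by rewrite -opscalerAl -opscalerAr scalerA. Qed.

Lemma innerP S x y : inner (S x) y = inner x (adjoint S y) :> A.
Proof. exact: opadjP. Qed.

Lemma selfadjoint_inner S x y :
  adjoint S = S -> inner (S x) y = inner x (S y) :> A.
Proof. by move=> sS; rewrite innerP sS. Qed.

Lemma opfunN S x : S (- x) = - S x.
Proof. by rewrite -scaleN1r opfunZ scaleN1r. Qed.

Lemma isometry_inner S x : adjoint S * S = 1 -> inner (S x) (S x) = inner x x :> A.
Proof. by move=> SS; rewrite innerP -[adjoint S (S x)]/((adjoint S * S) x) SS. Qed.

End OperatorAlgebra.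

Section Bounded.
Context {R : realType} {A : cstarAlgType R} {H : hilbertModType A}.
Implicit Types (S T : 'L(H)) (x y : H) (c d : R).

Lemma rnorm_inner x : rnorm (inner x x : A) = rnorm x ^+ 2.
Proof.
apply: (@complexI R); rewrite rnormE rmorphXn /= rnormE.
exact/esym/sqr_norm_inner.
Qed.

Lemma rnorm_inner_le x y : rnorm (inner x x : A) <= rnorm (inner y y : A) ->
  rnorm x <= rnorm y.
Proof. by rewrite !rnorm_inner ler_sqr ?nnegrE ?rnorm_ge0. Qed.

Lemma rnorm_isometry T x : adjoint T * T = 1 -> rnorm (T x) = rnorm x.
Proof.
by move=> TT; apply/le_anti/andP; split; apply: rnorm_inner_le;
  rewrite isometry_inner.
Qed.

Lemma polarization x y :
  rnorm (inner x y + inner y x : A) <= (rnorm x + rnorm y) ^+ 2.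
Proof.
have E : (inner x y + inner y x : A) + (inner x y + inner y x)
    = inner (x + y) (x + y) - inner (x - y) (x - y).
  rewrite !innerDl !innerDr !innerNl !innerNr opprK.
  move: (inner x x) (inner x y) (inner y x) (inner y y) => a b c d.
  rewrite !opprD !opprK;   rewrite [RHS](AC (2*2*(2*2)) ((1*5)*(4*8)*(2*3)*(6*7)))/=.
  by rewrite !subrr !add0r.
have := congr1 (@rnorm _ _) E.
rewrite rnormDD => e.
have h1 : rnorm (inner (x + y) (x + y) : A) <= (rnorm x + rnorm y) ^+ 2.
  by rewrite rnorm_inner ler_sqr ?nnegrE ?addr_ge0 ?rnorm_ge0 // rnormD.
have h2 : rnorm (inner (x - y) (x - y) : A) <= (rnorm x + rnorm y) ^+ 2.
  by rewrite rnorm_inner ler_sqr ?nnegrE ?addr_ge0 ?rnorm_ge0 // rnormB.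
have := rnormB (inner (x + y) (x + y) : A) (inner (x - y) (x - y)).
by rewrite -e; lra.
Qed.

(* The sharp constant 1 would need the order of the C*-algebra. *)
Lemma cauchy_schwarz x y : rnorm (inner x y : A) <= 4 * rnorm x * rnorm y.
Proof.
have base (z w : H) : rnorm (inner z w : A) <= (rnorm z + rnorm w) ^+ 2.
  have E : (inner z w : A) + inner z w = (inner z w + inner w z) -
      'i%C *: (inner z ('i%C *: w) + inner ('i%C *: w) z).
    rewrite innerZr innerZl scalerDr !scalerA.
    have -> : 'i%C * 'i%C = -1 :> R[i] by rewrite -expr2 sqr_i.
    have -> : 'i%C * conjc 'i%C = 1 :> R[i] by simpc.
    rewrite scaleN1r scale1r opprD opprK.
    by rewrite addrACA subrr addr0.
  have := congr1 (@rnorm _ _) E; rewrite rnormDD => e.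
  have h1 := polarization z w; have := polarization z ('i%C *: w).
  rewrite rnormZi => h2.
  have := rnormB (inner z w + inner w z : A)
    ('i%C *: (inner z ('i%C *: w) + inner ('i%C *: w) z)).
  by rewrite -e rnormZi; lra.
have [x0|x0] := eqVneq (rnorm x) 0.
  by rewrite (rnorm_eq0 x0) inner0l !rnorm0 mulr0 mul0r.
have [y0|y0] := eqVneq (rnorm y) 0.
  by rewrite (rnorm_eq0 y0) inner0r !rnorm0 mulr0.
have {}x0 : 0 < rnorm x by rewrite lt_def x0 rnorm_ge0.
have {}y0 : 0 < rnorm y by rewrite lt_def y0 rnorm_ge0.
(* For unit vectors [base] gives (1 + 1)^2, which is the constant 4. *)
have := base ((rnorm x)^-1%:C *: x) ((rnorm y)^-1%:C *: y).
rewrite innerZl innerZr conjc_real !rnormZ !ger0_norm ?invr_ge0 ?rnorm_ge0 //.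
rewrite !mulVf ?gt_eqF // mulrA -invfM mulrC ler_pdivrMr ?mulr_gt0 //.
lra.
Qed.

Definition bounded_by T c := forall x, rnorm (T x) <= c * rnorm x.

Lemma bounded_by1 : bounded_by 1 1.
Proof. by move=> x; rewrite mul1r. Qed.

Lemma bounded_byD S T c d :
  bounded_by S c -> bounded_by T d -> bounded_by (S + T) (c + d).
Proof.
by move=> Sc Td x; rewrite mulrDl (le_trans (rnormD _ _)) // lerD.
Qed.

Lemma bounded_byN S c : bounded_by S c -> bounded_by (- S) c.
Proof. by move=> Sc x; rewrite rnormN. Qed.

Lemma bounded_byM S T c d : 0 <= c ->
  bounded_by S c -> bounded_by T d -> bounded_by (S * T) (c * d).
Proof.
by move=> c0 Sc Td x; rewrite -mulrA (le_trans (Sc _)) // ler_wpM2l.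
Qed.

Lemma bounded_byZ k T c : bounded_by T c -> bounded_by (k%:C *: T) (`|k| * c).
Proof. by move=> Tc x; rewrite rnormZ -mulrA ler_wpM2l. Qed.

Lemma bounded_byW T c d : c <= d -> bounded_by T c -> bounded_by T d.
Proof.
by move=> cd Tc x; rewrite (le_trans (Tc x)) // ler_wpM2r ?rnorm_ge0.
Qed.

(** Boundedness is an explicit hypothesis instead of a consequence of adjointability via the uniform
    boundedness principle. For Q it comes from the finiteness of |P - Q|. *)
Definition bounded_op T := exists2 c, 0 <= c & bounded_by T c.

Lemma bounded_op1 : bounded_op 1.
Proof. by exists 1 => //; apply: bounded_by1. Qed.

Lemma bounded_opD S T : bounded_op S -> bounded_op T -> bounded_op (S + T).
Proof.
move=> [c c0 Sc] [d d0 Td]; exists (c + d); first exact: addr_ge0.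
exact: bounded_byD.
Qed.

Lemma bounded_opN S : bounded_op S -> bounded_op (- S).
Proof. by move=> [c c0 Sc]; exists c => //; apply: bounded_byN. Qed.

Lemma bounded_opB S T : bounded_op S -> bounded_op T -> bounded_op (S - T).
Proof. by move=> bS bT; apply: bounded_opD => //; apply: bounded_opN. Qed.

Lemma bounded_opM S T : bounded_op S -> bounded_op T -> bounded_op (S * T).
Proof.
move=> [c c0 Sc] [d d0 Td]; exists (c * d); first exact: mulr_ge0.
exact: bounded_byM.
Qed.

Lemma bounded_opZ (k : R[i]) T : bounded_op T -> bounded_op (k *: T).
Proof.
move=> [c c0 Tc]; have k0 : 0 <= complex.Re `|k| by rewrite normc_def sqrtr_ge0.
exists (complex.Re `|k| * c); first exact: mulr_ge0.
by move=> x; rewrite /= rnormZ_cplx -mulrA ler_wpM2l.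
Qed.

Lemma bounded_op_adjoint T : bounded_op T -> bounded_op (adjoint T).
Proof.
move=> [c c0 Tc]; exists (4 * c) => [|y]; first exact: mulr_ge0.
have := rnorm_ge0 (adjoint T y); rewrite le_eqVlt => /predU1P[<-|y0].
  by rewrite !mulr_ge0 ?rnorm_ge0.
rewrite -(ler_pM2r y0) -expr2 -rnorm_inner -innerP.
apply: le_trans (cauchy_schwarz _ _) _.
have := Tc (adjoint T y); have := rnorm_ge0 y => y0' h.
by have := ler_wpM2r y0' h; lra.
Qed.

End Bounded.

(** * Square roots *)

Lemma scaler_half {R : realType} {V : lmodType R[i]} (v : V) :
  2^-1%:C *: v + 2^-1%:C *: v = v.
Proof.
rewrite -scalerDl -rmorphD /= -[X in (X + _)%:C]div1r -[X in (_ + X)%:C]div1r.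
by rewrite -splitr scale1r.
Qed.

Section SquareRoot.
Context {R : realType} {A : cstarAlgType R} {H : hilbertModType A}.
Implicit Types (S T C X Y G : 'L(H)) (x y : H) (r c d M : R).

Lemma op_eq0 T r M : 0 <= r < 1 ->
  (forall n, bounded_by T (M * r ^+ n)) -> T = 0.
Proof.
move=> r01 TM; apply: adjointable_ext => x; apply: rnorm_eq0.
apply/le_anti/andP; split; last exact: rnorm_ge0.
apply: (@geometric_le0 _ r (M * rnorm x)) => // n.
by rewrite mulrAC; apply: TM.
Qed.

(** Plays the part of being a continuous function of S: it survives sums, products and limits, and
    two such operators commute by [bicommutant_comm]. *)
Definition bicommutant S T := forall G, G * S = S * G -> G * T = T * G.

Lemma bicommutant_refl S : bicommutant S S. Proof. by []. Qed.

Lemma bicommutant_trans S T X :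
  bicommutant S T -> bicommutant T X -> bicommutant S X.
Proof. by move=> ST TX G /ST/TX. Qed.

Lemma bicommutant1 S : bicommutant S 1.
Proof. by move=> G _; rewrite mulr1 mul1r. Qed.

Lemma bicommutantD S T X :
  bicommutant S T -> bicommutant S X -> bicommutant S (T + X).
Proof. by move=> ST SX G GS; rewrite mulrDr mulrDl ST ?SX. Qed.

Lemma bicommutantN S T : bicommutant S T -> bicommutant S (- T).
Proof. by move=> ST G GS; rewrite mulrN mulNr ST. Qed.

Lemma bicommutantM S T X :
  bicommutant S T -> bicommutant S X -> bicommutant S (T * X).
Proof. by move=> ST SX G GS; rewrite mulrA ST // -mulrA SX // mulrA. Qed.

Lemma bicommutantZ k S T : bicommutant S T -> bicommutant S (k *: T).
Proof. by move=> ST G GS; rewrite -opscalerAr -opscalerAl ST. Qed.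

Lemma bicommutant_comm S T X :
  bicommutant S T -> bicommutant S X -> T * X = X * T.
Proof. by move=> ST SX; apply: SX; rewrite ST. Qed.

(** A pointwise limit is an operator only once it has an adjoint. As every approximant is
    self-adjoint, the limit map is symmetric and can serve as its own adjoint. *)
Lemma selfadjoint_limit (T_ : nat -> 'L(H)) S r M : 0 <= r < 1 -> 0 <= M ->
  (forall n, adjoint (T_ n) = T_ n) -> (forall n, bicommutant S (T_ n)) ->
  (forall n, bounded_by (T_ n.+1 - T_ n) (M * r ^+ n)) ->
  exists T, [/\ adjoint T = T, bicommutant S T &
    forall n, bounded_by (T - T_ n) (M / (1 - r) * r ^+ n)].
Proof.
move=> r01 M0 saT STn dT; have /andP[r0 r1] := r01.
set K := M / (1 - r).
have : forall x, exists l, forall n, rnorm (l - T_ n x) <= K * rnorm x * r ^+ n.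
  move=> x; have Mx : 0 <= M * rnorm x by rewrite mulr_ge0 ?rnorm_ge0.
  have [|l ul] := geometric_limit r01 Mx (u := fun n => T_ n x).
    by move=> n; have := dT n x; rewrite mulrAC.
  by exists l => n; have := ul n; rewrite /K; lra.
move=> /choice[f fT].
have zero (a : A) c : (forall n, rnorm a <= c * r ^+ n) -> a = 0.
  move=> ac; apply: rnorm_eq0; apply/le_anti/andP; split; last exact: rnorm_ge0.
  exact: geometric_le0 ac.
have fsym x y : inner (f x) y = inner x (f y) :> A.
  apply/subr0_eq/(zero _ (8 * K * rnorm x * rnorm y)) => n.
  have -> : inner (f x) y - inner x (f y)
      = inner (f x - T_ n x) y - inner x (f y - T_ n y) :> A.
    rewrite innerDl innerDr innerNl innerNr (selfadjoint_inner _ _ (saT n)).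
    by rewrite opprD opprK addrACA addNr addr0.
  apply: le_trans (rnormB _ _) _.
  apply: le_trans (lerD (cauchy_schwarz _ _) (cauchy_schwarz _ _)) _.
  have := ler_wpM2r (rnorm_ge0 y) (fT x n).
  have := ler_wpM2l (rnorm_ge0 x) (fT y n).
  lra.
exists (Adjointable fsym); split.
- exact: adjointable_ext.
- move=> G GS; apply: adjointable_ext => x; apply: inner_injl => y /=.
  have [g g0 Gg] : exists2 g, 0 <= g & g = rnorm (adjoint G y).
    by exists (rnorm (adjoint G y)); rewrite ?rnorm_ge0.
  apply/subr0_eq/(zero _ (4 * K * (rnorm x * g + rnorm (G x) * rnorm y))) => n.
  have -> : inner (G (f x)) y - inner (f (G x)) y
      = inner (f x - T_ n x) (adjoint G y) - inner (f (G x) - T_ n (G x)) y :> A.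
    have GT : G (T_ n x) = T_ n (G x).
      by rewrite -[LHS]/((G * T_ n) x) STn.
    rewrite !innerDl !innerNl -!innerP GT.
    by rewrite opprD opprK addrACA addNr addr0.
  apply: le_trans (rnormB _ _) _.
  apply: le_trans (lerD (cauchy_schwarz _ _) (cauchy_schwarz _ _)) _.
  rewrite -Gg.
  have := ler_wpM2r g0 (fT x n).
  have := ler_wpM2r (rnorm_ge0 y) (fT (G x) n).
  lra.
- by move=> n x; rewrite mulrAC; apply: fT.
Qed.

(** Iterate C -> (Y + C^2)/2 from 0: a fixed point satisfies (1 - C)^2 = 1 - Y, so X = 1 - C. All
    iterates have bound r since (r + r^2)/2 <= r, and therefore successive differences shrink by the
    factor r. *)
Lemma selfadjoint_sqrt Y r : 0 <= r < 1 -> adjoint Y = Y -> bounded_by Y r ->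
  exists X, [/\ adjoint X = X, bicommutant Y X, X * X = 1 - Y &
    bounded_by (1 - X) r].
Proof.
move=> r01 saY Yr; have /andP[r0 r1] := r01.
pose T_ := fix T_ n := if n is n.+1 then 2^-1%:C *: (Y + T_ n * T_ n) else 0.
have TS n : T_ n.+1 + T_ n.+1 = Y + T_ n * T_ n by exact: scaler_half.
have saT n : adjoint (T_ n) = T_ n.
  elim: n => [|n IH]; first exact: adjointable_ext.
  by rewrite adjointZr adjointD adjointM saY IH.
have YT n : bicommutant Y (T_ n).
  elim: n => [|n IH]; first by move=> G _; rewrite mulr0 mul0r.
  by apply: bicommutantZ; apply: bicommutantD => //; apply: bicommutantM.
have h0 : 0 <= 2^-1 :> R by lra.
have Tr n : bounded_by (T_ n) r.
  elim: n => [|n IH]; first by move=> x; rewrite /= rnorm0 mulr_ge0 ?rnorm_ge0.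
  apply: bounded_byW (bounded_byZ _ (bounded_byD Yr (bounded_byM r0 IH IH))).
  by rewrite ger0_norm //; nra.
have dT n : bounded_by (T_ n.+1 - T_ n) (1 * r ^+ n).
  elim: n => [|n IH].
    rewrite /= mulr0 addr0 subr0.
    by apply: bounded_byW (bounded_byZ _ Yr); rewrite ger0_norm //; lra.
  have -> : T_ n.+2 - T_ n.+1
      = 2^-1%:C *: ((T_ n.+1 + T_ n) * (T_ n.+1 - T_ n)).
    rewrite -[T_ n.+2]/(2^-1%:C *: (Y + T_ n.+1 * T_ n.+1)).
    rewrite -[X in _ - X]/(2^-1%:C *: (Y + T_ n * T_ n)) -scalerBr.
    congr (_ *: _); have := bicommutant_comm (YT n.+1) (YT n).
    move: (T_ n.+1) (T_ n) => a b ab.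
    rewrite mulrDl !mulrBr ab; ncring.
  apply: bounded_byW (bounded_byZ _ (bounded_byM _ (bounded_byD (Tr _) (Tr _)) IH)).
    by rewrite ger0_norm // exprS; lra.
  by lra.
have [C [saC YC TC]] := selfadjoint_limit r01 ler01 saT YT dT.
set K := 1 / (1 - r) in TC.
have K0 : 0 <= K by rewrite divr_ge0 //; lra.
have Cr : bounded_by C r.
  move=> x; rewrite -subr_le0; apply: (@geometric_le0 _ r (K * rnorm x)) => // n.
  have := rnormD ((C - T_ n) x) (T_ n x); rewrite /= subrK.
  by have := Tr n x; have := TC n x; rewrite /=; lra.
have CC : C + C = Y + C * C.
  apply/subr0_eq/(@op_eq0 _ r (4 * K)) => // n.
  have -> : C + C - (Y + C * C) = ((C - T_ n.+1) + (C - T_ n.+1))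
      - (C * (C - T_ n) + (C - T_ n) * T_ n).
    transitivity (C + C - (T_ n.+1 + T_ n.+1)
      - (C * (C - T_ n) + (C - T_ n) * T_ n)); last by move: (T_ n.+1) => a; ncring.
    by rewrite TS; move: (T_ n) => a; ncring.
  have Tn1 : bounded_by (C - T_ n.+1) (K * r ^+ n).
    apply: bounded_byW (TC _); rewrite exprS ler_wpM2l //.
    by rewrite ler_piMl ?exprn_ge0 // ltW.
  have Kn : 0 <= K * r ^+ n by rewrite mulr_ge0 ?exprn_ge0.
  apply: bounded_byW (bounded_byD (bounded_byD Tn1 Tn1) (bounded_byN
    (bounded_byD (bounded_byM r0 Cr (TC n)) (bounded_byM Kn (TC n) (Tr n))))).
  by have := ler_wpM2r Kn (ltW r1); lra.
exists (1 - C); split.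
- by rewrite adjointB adjoint1 saC.
- by apply: bicommutantD; [apply: bicommutant1|apply: bicommutantN].
- transitivity (1 - (C + C) + C * C); first by ncring.
  by rewrite CC; ncring.
- by rewrite opprB addrC subrK.
Qed.

Lemma selfadjoint_neumann C r : 0 <= r < 1 -> adjoint C = C -> bounded_by C r ->
  exists G, [/\ adjoint G = G, bicommutant C G, bounded_op G & (1 - C) * G = 1].
Proof.
move=> r01 saC Cr; have /andP[r0 r1] := r01.
pose T_ := fix T_ n := if n is n.+1 then 1 + C * T_ n else 0.
have CT n : bicommutant C (T_ n).
  elim: n => [|n IH]; first by move=> G _; rewrite mulr0 mul0r.
  by apply: bicommutantD; [apply: bicommutant1|apply: bicommutantM].
have saT n : adjoint (T_ n) = T_ n.
  elim: n => [|n IH]; first exact: adjointable_ext.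
  by rewrite /= adjointD adjointM adjoint1 saC IH CT.
have dT n : bounded_by (T_ n.+1 - T_ n) (1 * r ^+ n).
  rewrite mul1r; elim: n => [|n IH].
    by rewrite /= mulr0 addr0 subr0; exact: bounded_by1.
  have -> : T_ n.+2 - T_ n.+1 = C * (T_ n.+1 - T_ n).
    by rewrite /= opprD addrACA subrr add0r -mulrBr.
  by rewrite exprS; apply: bounded_byM.
have [G [saG CG TG]] := selfadjoint_limit r01 ler01 saT CT dT.
set K := 1 / (1 - r) in TG.
have K0 : 0 <= K by rewrite divr_ge0 //; lra.
exists G; split=> //.
  by exists (K * r ^+ 0); [rewrite mulr1|have := TG 0; rewrite subr0].
apply/subr0_eq/(@op_eq0 _ r (2 * K)) => // n.
have -> : (1 - C) * G - 1 = (G - T_ n.+1) - C * (G - T_ n).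
  by rewrite /=; move: (T_ n) => a; ncring.
have Kn : 0 <= K * r ^+ n by rewrite mulr_ge0 ?exprn_ge0.
apply: bounded_byW (bounded_byD (TG _) (bounded_byN (bounded_byM r0 Cr (TG n)))).
by have := ler_wpM2r Kn (ltW r1); rewrite exprS; lra.
Qed.

End SquareRoot.

(** * Norm bounds from K^2 + L^2 = c^2 *)

Section Squares.
Context {R : realType} {A : cstarAlgType R} {H : hilbertModType A}.
Implicit Types (S T K L G : 'L(H)) (x y : H) (k c d e m : R).

Lemma rnorm_complex_isometry K L c x : 0 <= c ->
  adjoint K = K -> adjoint L = L -> K * L = L * K ->
  K * K + L * L = (c ^+ 2)%:C *: (1 : 'L(H)) -> rnorm (K x + 'i%C *: L x) = c * rnorm x.
Proof.
move=> c0 saK saL KL KKLL.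
suff E : inner (K x + 'i%C *: L x) (K x + 'i%C *: L x)
    = inner (c%:C *: x) (c%:C *: x) :> A.
  have : rnorm (K x + 'i%C *: L x) = rnorm (c%:C *: x).
    by apply/le_anti/andP; split; apply: rnorm_inner_le; rewrite E.
  by rewrite rnormZ ger0_norm.
rewrite innerDl !innerDr !innerZl !innerZr !scalerA conjc_real.
rewrite !(selfadjoint_inner _ _ saK) !(selfadjoint_inner _ _ saL).
have -> : L (K x) = K (L x) by rewrite -[LHS]/((L * K) x) -KL.
have -> : conjc 'i%C * 'i%C = 1 :> R[i] by simpc.
have -> : conjc 'i%C = - 'i%C :> R[i] by simpc.
rewrite scale1r scaleNr -addrA addNKr -innerDr.
rewrite -[K (K x) + _]/((K * K + L * L) x) KKLL /= innerZr.
by rewrite -rmorphM expr2.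
Qed.

(* K is the average of the isometries K + iL and K - iL, up to the factor c. *)
Lemma bounded_by_average K L c : 0 <= c ->
  adjoint K = K -> adjoint L = L -> K * L = L * K ->
  K * K + L * L = (c ^+ 2)%:C *: (1 : 'L(H)) -> bounded_by K c.
Proof.
move=> c0 saK saL KL KKLL x.
have h1 := rnorm_complex_isometry x c0 saK saL KL KKLL.
have := @rnorm_complex_isometry K (- L) c x c0 saK.
rewrite adjointN saL mulrN mulNr KL mulrNN => /(_ erefl erefl KKLL) h2.
have := rnormD (K x + 'i%C *: L x) (K x + 'i%C *: (- L) x).
rewrite h1 h2 /= scalerN addrACA subrr addr0 rnormDD.
by lra.
Qed.

(** Replaces the order argument 0 <= c^2 - K^2 <= c^2; the triangle inequality alone would give c^2
    + k^2. With L a square root of c^2 - K^2, averaging applies with the roles of K and L exchanged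
    and bounds L by c. *)
Lemma bounded_by_square_complement K k c : 0 <= k < c ->
  adjoint K = K -> bounded_by K k ->
  bounded_by ((c ^+ 2)%:C *: (1 : 'L(H)) - K * K) (c ^+ 2).
Proof.
move=> /andP[k0 kc] saK Kk; have c0 : 0 < c by lra.
pose Y := (c ^- 2)%:C *: (K * K).
have saY : adjoint Y = Y by rewrite adjointZr adjointM saK.
have Yr : bounded_by Y (c ^- 2 * (k * k)).
  apply: bounded_byW (bounded_byZ _ (bounded_byM k0 Kk Kk)).
  by rewrite ger0_norm ?invr_ge0 ?exprn_ge0 // ltW.
have r01 : 0 <= c ^- 2 * (k * k) < 1.
  rewrite !mulr_ge0 ?invr_ge0 ?exprn_ge0 ?(ltW c0) //=.
  by rewrite mulrC ltr_pdivrMr ?exprn_gt0 // mul1r -expr2 ltr_pXn2r // nnegrE ltW.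
have [X [saX YX XX _]] := selfadjoint_sqrt r01 saY Yr.
pose L := c%:C *: X.
have LL : L * L = (c ^+ 2)%:C *: (1 : 'L(H)) - K * K.
  rewrite /L -opscalerAr -opscalerAl XX scalerA -rmorphM -expr2 scalerBr.
  by rewrite scalerA -rmorphM divff ?scale1r // expf_neq0 // gt_eqF.
have saL : adjoint L = L by rewrite adjointZr saX.
have KL : L * K = K * L.
  rewrite /L -opscalerAr -opscalerAl; congr (_ *: _); apply/esym/YX.
  by rewrite /Y -opscalerAr -opscalerAl mulrA.
have Lc : bounded_by L c.
  apply: (bounded_by_average (ltW c0) saL saK) => //.
  by rewrite LL subrK.
by rewrite -LL expr2; apply: bounded_byM => //; apply: ltW.
Qed.

(** Two successive roots are extracted so that the square root [S * S] of 1 + K^2 is visibly a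
    square; [G] is the Neumann inverse. *)
Lemma sqrt_one_plus_square K : adjoint K = K -> bounded_op K ->
  exists S G, [/\ [/\ adjoint S = S, bicommutant (K * K) S & bounded_op S],
    [/\ adjoint G = G, bicommutant (K * K) G & bounded_op G],
    (S * S) * (S * S) = 1 + K * K & (1 + K * K) * G = 1].
Proof.
move=> saK [k k0 Kk]; pose c := k + 1; have kc : 0 <= k < c by rewrite /c; lra.
have c0 : 0 < c by rewrite /c; lra.
have := bounded_by_square_complement kc saK Kk.
(* The choice of d gives 1 + K^2 = d (1 - Y) with Y = (c^2 - K^2)/d of bound c^2/(1 + c^2) < 1. *)
set D := _ - K * K => Dc; pose d := 1 + c ^+ 2.
have c20 : 0 < c ^+ 2 by rewrite exprn_gt0.
have d0 : 0 < d by rewrite /d; lra.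
pose Y := d^-1%:C *: D; pose r := d^-1 * c ^+ 2.
have KD : bicommutant (K * K) D.
  apply: bicommutantD; first exact/bicommutantZ/bicommutant1.
  exact: bicommutantN.
have KY : bicommutant (K * K) Y by apply: bicommutantZ.
have saY : adjoint Y = Y.
  by rewrite adjointZr adjointB adjointM saK adjointZr adjoint1.
have Yr : bounded_by Y r.
  by apply: bounded_byW (bounded_byZ _ Dc); rewrite ger0_norm // invr_ge0 ltW.
have r01 : 0 <= r < 1.
  rewrite /r mulr_ge0 ?invr_ge0 ?ltW //=.
  by rewrite mulrC ltr_pdivrMr // mul1r /d; lra.
have dY : d%:C *: (1 - Y) = 1 + K * K.
  rewrite /Y scalerBr scalerA -rmorphM divff ?gt_eqF // scale1r /D /d.
  by rewrite rmorphD rmorph1 scalerDl scale1r; ncring.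
have [X1 [saX1 YX1 XX1 X1r]] := selfadjoint_sqrt r01 saY Yr.
have sa1 : adjoint (1 - X1) = 1 - X1 by rewrite adjointB adjoint1 saX1.
have [X2 [saX2 YX2 XX2 X2r]] := selfadjoint_sqrt r01 sa1 X1r.
have KX2 : bicommutant (K * K) X2.
  apply: bicommutant_trans YX2; apply: bicommutantD (@bicommutant1 _ _ _ _) _.
  by apply: bicommutantN; apply: bicommutant_trans YX1.
have bX2 : bounded_op X2.
  rewrite -[X2](subKr 1); apply: bounded_opB; first exact: bounded_op1.
  by exists r => //; case/andP: r01.
have [G0 [saG0 YG0 bG0 G0E]] := selfadjoint_neumann r01 saY Yr.
pose s := Num.sqrt (Num.sqrt d).
have sE : s * s * (s * s) = d.
  by rewrite -!expr2 !sqr_sqrtr ?sqrtr_ge0 // ltW.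
exists (s%:C *: X2), (d^-1%:C *: G0); split; [split|split| |].
- by rewrite adjointZr saX2.
- exact: bicommutantZ.
- exact: bounded_opZ.
- by rewrite adjointZr saG0.
- by apply: bicommutantZ; apply: bicommutant_trans YG0.
- exact: bounded_opZ.
- by rewrite !opscalerM XX2 -!rmorphM sE subKr XX1 dY.
- rewrite -dY -opscalerAr -opscalerAl G0E scalerA -rmorphM mulVf ?scale1r //.
  by rewrite gt_eqF.
Qed.

End Squares.

(** * Accretive operators *)

Section Accretive.
Context {R : realType} {A : cstarAlgType R} {H : hilbertModType A}.
Implicit Types (S T K L G : 'L(H)) (x y : H) (k c d e m : R).

(** Turns a first-order loss against a second-order error into a contradiction. The witness d/(m +
    d) is at most 1, so that e can be a convex weight. *)
Lemma first_order_dominates d m : 0 < d -> 0 <= m ->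
  ~ (forall e, 0 < e <= 1 -> e * d <= e ^+ 2 * m).
Proof.
move=> d0 m0 /(_ (d / (m + d))).
have md : 0 < m + d by lra.
rewrite divr_gt0 // ler_pdivrMr // mul1r lerDr m0 => /(_ isT).
rewrite expr2 -[_ * _ * m]mulrA ler_pM2l ?divr_gt0 //.
by rewrite mulrAC ler_pdivlMr //; nra.
Qed.

(* Lumer-Phillips accretivity stands in for positivity: it is stable under sums
   by the triangle inequality alone, without the order of the C*-algebra. *)
Definition accretive T :=
  forall k x, 0 <= k -> rnorm x <= rnorm (x + k%:C *: T x).

(** The triangle inequality in A gives the claim for a step e up to an error e^2 |v|^2. If the full
    step shortened x by d, convexity of the norm would make the step e shorten it by at least e d,
    which is of first order. *)
Lemma rnorm_skew_perturbation K k x : adjoint K = K ->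
  rnorm x <= rnorm (x + 'i%C *: (k%:C *: K x)).
Proof.
move=> saK; set v := k%:C *: K x.
have step e : rnorm x ^+ 2 <=
    rnorm (x + 'i%C *: (e%:C *: v)) ^+ 2 + e ^+ 2 * rnorm v ^+ 2.
  have E : inner x x = inner (x + 'i%C *: (e%:C *: v)) (x + 'i%C *: (e%:C *: v))
      - inner (e%:C *: v) (e%:C *: v) :> A.
    have xv : inner (e%:C *: v) x = inner x (e%:C *: v) :> A.
      rewrite /v !innerZl !innerZr !conjc_real.
      by rewrite (selfadjoint_inner _ _ saK).
    rewrite innerDl !innerDr !(innerZl 'i%C) !(innerZr 'i%C) xv scalerA.
    have -> : conjc 'i%C * 'i%C = 1 :> R[i] by simpc.
    have -> : conjc 'i%C = - 'i%C :> R[i] by simpc.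
    by rewrite scale1r scaleNr -[inner x x + _ + _]addrA addNKr addrK.
  rewrite -rnorm_inner E; apply: le_trans (rnormB _ _) _.
  by rewrite !rnorm_inner rnormZ exprMn real_normK ?num_real.
rewrite leNgt; apply/negP => lt_x.
set y := x + 'i%C *: v in lt_x.
have y0 := rnorm_ge0 y.
pose d := rnorm x - rnorm y; have d0 : 0 < d by rewrite /d; lra.
have x0 : 0 < rnorm x by lra.
have : 0 < 2 * d * rnorm x by rewrite !mulr_gt0.
move=> /first_order_dominates /(_ (_ : 0 <= d ^+ 2 + rnorm v ^+ 2)); apply.
  by rewrite addr_ge0 ?sqr_ge0.
move=> e /andP[e0 e1].
have e1' : 0 <= 1 - e by lra.
have : rnorm (x + 'i%C *: (e%:C *: v)) <= rnorm x - e * d.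
  have -> : x + 'i%C *: (e%:C *: v) = (1 - e)%:C *: x + e%:C *: y.
    rewrite rmorphB rmorph1 scalerBl scale1r /y scalerDr addrA subrK.
    by congr (x + _); rewrite !scalerA; congr (_ *: _); ring.
  apply: le_trans (rnormD _ _) _; rewrite !rnormZ !ger0_norm ?(ltW e0) //.
  by rewrite /d; lra.
move=> h; have := rnorm_ge0 (x + 'i%C *: (e%:C *: v)) => h0.
have h' : 0 <= rnorm x - e * d by lra.
have := step e; have : rnorm (x + 'i%C *: (e%:C *: v)) ^+ 2 <= (rnorm x - e * d) ^+ 2.
  by rewrite ler_sqr.
by lra.
Qed.

(** With s^2 = k, 1 + k K^2 = (1 - isK)(1 + isK), and neither factor shortens a vector. *)
Lemma accretive_square K : adjoint K = K -> accretive (K * K).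
Proof.
move=> saK k x k0; pose s := Num.sqrt k.
have sE : s * s = k by rewrite -expr2 sqr_sqrtr.
apply: le_trans (rnorm_skew_perturbation s x saK) _.
apply: le_trans (rnorm_skew_perturbation (- s) _ saK) _.
rewrite le_eqVlt; apply/orP; left; apply/eqP; congr rnorm.
rewrite opfunD !opfunZ -addrA; congr (x + _).
rewrite !scalerDr !scalerA addrA -scalerDl.
have -> : 'i%C * s%:C + 'i%C * (- s)%:C = 0.
  by rewrite -mulrDr -rmorphD /= subrr mulr0.
rewrite scale0r add0r; congr (_ *: _).
have i2 : 'i%C * 'i%C = -1 :> R[i] by rewrite -expr2 sqr_i.
rewrite -sE rmorphM rmorphN; transitivity (- ('i%C * 'i%C) * (s%:C * s%:C)).
  by ring.
by rewrite i2; ring.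
Qed.

(** The product (1 + ekS)(1 + ekT) shortens no vector and differs from 1 + ek(S + T) by e^2 k^2 S T
    only. By convexity, a loss at e = 1 would be a first-order loss for small e. *)
Lemma accretiveD S T : bounded_op S -> bounded_op T ->
  accretive S -> accretive T -> accretive (S + T).
Proof.
move=> bS bT aS aT k x k0; rewrite leNgt; apply/negP => lt_x.
set y := x + _ in lt_x.
have := lt_x; rewrite -subr_gt0 => /first_order_dominates.
move=> /(_ _ (mulr_ge0 (sqr_ge0 k) (rnorm_ge0 (S (T x))))); apply.
move=> e /andP[e0 e1]; have ek0 : 0 <= e * k by rewrite mulr_ge0 // ltW.
have e1' : 0 <= 1 - e by lra.
have := le_trans (aT _ x ek0) (aS _ _ ek0).
have -> : x + (e * k)%:C *: T x + (e * k)%:C *: S (x + (e * k)%:C *: T x)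
    = (1 - e)%:C *: x + e%:C *: y + (e ^+ 2 * k ^+ 2)%:C *: S (T x).
  have -> : e%:C *: y = e%:C *: x + ((e * k)%:C *: T x + (e * k)%:C *: S x).
    by rewrite /y /= scalerDr scalerA -rmorphM scalerDr [in RHS](addrC (_ *: T x)).
  rewrite opfunD opfunZ scalerDr scalerA -rmorphM -expr2 exprMn.
  by rewrite rmorphB rmorph1 scalerBl scale1r addrA (addrA _ (e%:C *: x)) subrK
    !addrA.
move=> h; have := le_trans h (rnormD _ _).
have ek2 : 0 <= e ^+ 2 * k ^+ 2 by rewrite -exprMn sqr_ge0.
rewrite rnormZ (ger0_norm ek2) => {}h.
have := rnormD ((1 - e)%:C *: x) (e%:C *: y).
rewrite !rnormZ !ger0_norm ?(ltW e0) //.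
by lra.
Qed.

(** A special case of the theorem that [adjoint S * S] has non-negative spectrum, enough for
    uniqueness of positive roots. *)
Lemma negative_square_eq0 (S e : 'L(H)) : bounded_op S -> bounded_op e ->
  adjoint e = e -> e * e = e -> S * e = S -> adjoint S * S = - e -> e = 0.
Proof.
move=> bS be sae ee Se SSe.
(* f := - S S* is another projection; with a, b the real and imaginary parts
   of S (doubled), a^2 + b^2 = 2 (S S* + S* S) = - 2 f - 2 e. *)
pose f := - (S * adjoint S).
pose a := S + adjoint S; pose b := 'i%C *: (S - adjoint S).
have saf : adjoint f = f by rewrite adjointN adjointM adjointK.
have sa_a : adjoint a = a by rewrite adjointD adjointK addrC.
have sa_b : adjoint b = b.
  have ci : conjc 'i%C = - 'i%C :> R[i] by simpc.
  by rewrite adjointZ ci adjointB adjointK scaleNr -scalerN opprB.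
have ff : f * f = f.
  rewrite /f mulrNN mulrA -(mulrA S) SSe mulrN mulNr.
  by rewrite Se.
have bf : bounded_op f.
  by apply/bounded_opN/bounded_opM => //; apply: bounded_op_adjoint.
have ba : bounded_op a by apply: bounded_opD => //; apply: bounded_op_adjoint.
have bb : bounded_op b.
  by apply/bounded_opZ/bounded_opB => //; apply: bounded_op_adjoint.
have E : (a * a + b * b) + (f * f + f * f) = - e - e.
  have bbE : b * b = - ((S - adjoint S) * (S - adjoint S)).
    by rewrite opscalerM -expr2 sqr_i scaleN1r.
  rewrite bbE ff /f /a -SSe; ncring.
have acc : accretive (- e - e).
  have [baa bbb bff] : [/\ bounded_op (a * a), bounded_op (b * b) & bounded_op (f * f)].
    by split; apply: bounded_opM.
  rewrite -E; apply: accretiveD; [exact: bounded_opD..| |];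
    by apply: accretiveD => //; apply: accretive_square.
apply: adjointable_ext => x; apply: rnorm_eq0; apply/le_anti.
rewrite rnorm_ge0 andbT; have h0 : 0 <= 2^-1 :> R by rewrite invr_ge0.
(* The step 1/2 is chosen because 1 + (1/2)(- 2e) annihilates the vector e x. *)
have := acc _ (e x) h0; rewrite /=.
have -> : e (e x) = e x by rewrite -[LHS]/((e * e) x) ee.
by rewrite -opprD scalerN scalerDr scaler_half subrr rnorm0.
Qed.

End Accretive.

(** * Distance from 1 of a positive invertible operator *)

Lemma comm_sqr (V : pzRingType) (a b : V) :
  a * b = b * a -> (a * b) * (a * b) = (a * a) * (b * b).
Proof. by move=> ab; rewrite !mulrA -(mulrA a b a) -ab !mulrA. Qed.

Section PositiveInvertible.
Context {R : realType} {A : cstarAlgType R} {H : hilbertModType A}.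
Implicit Types (S T K L G : 'L(H)) (x y : H) (k c d e m : R).

Lemma bicommutant_inverse T T' : T * T' = 1 -> T' * T = 1 -> bicommutant T T'.
Proof.
move=> TT' T'T G GT; rewrite -[G * T']mul1r -T'T -!mulrA.
by rewrite (mulrA T) -GT -mulrA TT' mulr1.
Qed.

Lemma adjoint_comm S T :
  adjoint S = S -> adjoint T = T -> S * T = T * S -> adjoint (S * T) = S * T.
Proof. by move=> saS saT ST; rewrite adjointM saS saT ST. Qed.

(* The equation T + T^-1 = 2 S^2 with S self-adjoint expresses that T is
   positive. Its spectrum lies in [1/d, d], an interval of midpoint tau and
   half-length rho, and L below satisfies (T - tau)^2 + L^2 = rho^2. *)
Lemma bounded_by_sub1 T T' S c d : 1 <= c -> c < d ->
  adjoint T = T -> T * T' = 1 -> T' * T = 1 ->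
  adjoint S = S -> bounded_op S -> bicommutant T S -> T + T' = S * S + S * S ->
  bounded_by T c -> bounded_by T' c -> bounded_by (1 - T) (d - 1).
Proof.
move=> c1 cd saT TT' T'T saS bS TS TTS Tc T'c.
have d0 : 0 < d by lra.
have dV0 : 0 < d^-1 by rewrite invr_gt0.
have saT' : adjoint T' = T'.
  rewrite -[LHS]mulr1 -TT' mulrA.
  by rewrite -[X in _ * X * _]saT -adjointM TT' adjoint1 mul1r.
have TT'c := bicommutant_inverse TT' T'T.
have r01 : 0 <= d^-1 * c < 1.
  rewrite mulr_ge0 ?ltW //=; last by lra.
  by rewrite mulrC ltr_pdivrMr // mul1r.
have bV (V : 'L(H)) : bounded_by V c -> bounded_by (d^-1%:C *: V) (d^-1 * c).
  by move=> Vc; apply: bounded_byW (bounded_byZ _ Vc); rewrite ger0_norm // ltW.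
have saV (V : 'L(H)) : adjoint V = V -> adjoint (d^-1%:C *: V) = d^-1%:C *: V.
  by move=> sV; rewrite adjointZr sV.
have [X1 [saX1 YX1 XX1 _]] := selfadjoint_sqrt r01 (saV _ saT) (bV _ Tc).
have [X2 [saX2 YX2 XX2 _]] := selfadjoint_sqrt r01 (saV _ saT') (bV _ T'c).
have [S1 [G1 [[saS1 SS1 _] [saG1 SG1 _] S1E G1E]]] := sqrt_one_plus_square saS bS.
have TX1 : bicommutant T X1.
  by apply: bicommutant_trans YX1; apply: bicommutantZ.
have TX2 : bicommutant T X2.
  by apply: bicommutant_trans YX2; apply: bicommutantZ.
have TSS : bicommutant T (S * S) by apply: bicommutantM.
(* [E] is (1 + S^2)^(-1/2). As (T + 1)^2 = 2 T (1 + S^2), the product (T + 1) E is a self-adjoint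
   square root of 2T. *)
pose E := S1 * S1 * G1.
have TS1 : bicommutant T S1 by apply: bicommutant_trans SS1.
have TG1 : bicommutant T G1 by apply: bicommutant_trans SG1.
have TE : bicommutant T E by do 2?[apply: bicommutantM].
have comm X Y : bicommutant T X -> bicommutant T Y -> X * Y = Y * X.
  exact: bicommutant_comm.
have saE : adjoint E = E.
  apply: adjoint_comm => //; first exact: adjoint_comm.
  by apply: comm => //; apply: bicommutantM.
have EE : (1 + S * S) * (E * E) = 1.
  rewrite comm_sqr; last by apply: comm => //; apply: bicommutantM.
  by rewrite S1E !mulrA -(mulrA (1 + _)) G1E mulr1 G1E.
have TT1 : (T + 1) * (T + 1) = T * (1 + S * S) + T * (1 + S * S).
  transitivity (T + T + T * (S * S + S * S)); last by ncring.
  by rewrite -TTS [T * (T + _)]mulrDr TT'; ncring.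
pose a := d^-1; pose tau := (d + a) / 2; pose rho := (d - a) / 2.
have ad : a * d = 1 by rewrite mulVf // gt_eqF.
have XX : T * ((X1 * X1) * (X2 * X2))
    = (1 + a * a)%:C *: T - a%:C *: (T * T + 1).
  have -> : (X1 * X1) * (X2 * X2) = (1 + a * a)%:C *: (1 : 'L(H)) - a%:C *: (T + T').
    rewrite XX1 XX2 mulrBl !mulrBr !mul1r mulr1 opscalerM TT' -rmorphM.
    rewrite rmorphD rmorph1 scalerDl scale1r scalerDr -/a.
    ncring.
  by rewrite mulrBr -!opscalerAr mulr1 mulrDr TT'.
(* Built as a root of d T (1 - T/d)(1 - T'/d) = (d - T)(T - 1/d), which equals rho^2 - (T -
   tau)^2. *)
pose L := (Num.sqrt (d / 2))%:C *: ((T + 1) * ((X1 * X2) * E)).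
have TT1c : bicommutant T (T + 1).
  by apply: bicommutantD => //; apply: bicommutant1.
have TXX : bicommutant T (X1 * X2) by apply: bicommutantM.
have TXXE : bicommutant T (X1 * X2 * E) by apply: bicommutantM.
have TL : bicommutant T L by apply: bicommutantZ; apply: bicommutantM.
have saL : adjoint L = L.
  rewrite adjointZr adjoint_comm //; first by rewrite adjointD saT adjoint1.
    by apply: adjoint_comm => //; [apply: adjoint_comm => //|]; apply: comm.
  exact: comm.
have LL : L * L = (d + a)%:C *: T - (T * T + 1).
  rewrite opscalerM comm_sqr; last exact: comm.
  rewrite (comm_sqr (comm _ _ TXX TE)) (comm_sqr (comm _ _ TX1 TX2)).
  have -> : (T + 1) * (T + 1) * (X1 * X1 * (X2 * X2) * (E * E))
      = T * (X1 * X1 * (X2 * X2)) + T * (X1 * X1 * (X2 * X2)).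
    rewrite TT1 mulrDl.
    suff -> : T * (1 + S * S) * (X1 * X1 * (X2 * X2) * (E * E)) =
      T * (X1 * X1 * (X2 * X2)) by [].
    rewrite -mulrA; congr (T * _); rewrite mulrA (comm (1 + S * S)).
    - by rewrite -mulrA EE mulr1.
    - by apply: bicommutantD => //; apply: bicommutant1.
    - by do 2?[apply: bicommutantM].
  rewrite XX -rmorphM -expr2 sqr_sqrtr; last by rewrite divr_ge0 ?ltW.
  rewrite scalerDr -scalerDl -rmorphD -splitr scalerBr !scalerA -!rmorphM.
  by rewrite mulrDr mulr1 mulrA (mulrC d) ad mul1r rmorph1 scale1r.
pose D := T - tau%:C *: (1 : 'L(H)).
have TD : bicommutant T D.
  by apply/bicommutantD/bicommutantN/bicommutantZ/bicommutant1.
have saD : adjoint D = D by rewrite adjointB saT adjointZr adjoint1.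
have DL : D * D + L * L = (rho ^+ 2)%:C *: (1 : 'L(H)).
  have -> : rho ^+ 2 = tau * tau - 1.
    by rewrite /rho /tau; lra.
  have tT : (d + a)%:C *: T = tau%:C *: T + tau%:C *: T.
    by rewrite -scalerDl -rmorphD -splitr.
  rewrite LL tT /D mulrBl !mulrBr opscalerM -opscalerAr -opscalerAl !mulr1 mul1r.
  rewrite -rmorphM rmorphB rmorph1 scalerBl scale1r.
  ncring.
have a1 : a < 1 by rewrite invf_lt1 //; lra.
have rho0 : 0 <= rho by rewrite divr_ge0 //; lra.
have Drho := bounded_by_average rho0 saD saL (comm _ _ TD TL) DL.
have tau1 : 1 <= tau.
  have : 0 <= (d - 1) * (1 - a) by apply: mulr_ge0; lra.
  by rewrite /tau; lra.
have -> : 1 - T = (1 - tau)%:C *: (1 : 'L(H)) - D.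
  by rewrite /D rmorphB rmorph1 scalerBl scale1r; ncring.
apply: bounded_byW (bounded_byD (bounded_byZ _ bounded_by1) (bounded_byN Drho)).
have tr : tau + rho = d by rewrite /tau /rho; lra.
by rewrite ler0_norm ?mulr1; lra.
Qed.

End PositiveInvertible.

(** * Uniqueness of positive square roots *)

Section PositiveRoot.
Context {R : realType} {A : cstarAlgType R} {H : hilbertModType A}.
Implicit Types (S T M P Q Z : 'L(H)).

(** Used twice in a row below: for b = [adjoint T * T], known only through its bounded square, and
    then for T itself. *)
Lemma bounded_op_square T : bounded_op (adjoint T * T) -> bounded_op T.
Proof.
move=> [c c0 TT]; exists (Num.sqrt (4 * c)) => [|x]; first exact: sqrtr_ge0.
rewrite -ler_sqr ?nnegrE ?mulr_ge0 ?sqrtr_ge0 ?rnorm_ge0 //.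
rewrite exprMn sqr_sqrtr ?mulr_ge0 // -rnorm_inner innerP.
apply: le_trans (cauchy_schwarz _ _) _.
have := ler_wpM2l (rnorm_ge0 x) (TT x); rewrite /=; lra.
Qed.

(** Compare b = [adjoint T * T] with the root N = S^2 of Z: v = b M is a self-adjoint root of P, and
    e = (P - v)/2 projects onto its eigenspace for -1. There b acts as - N, which contradicts
    positivity of b unless e = 0; then v = P and b = N P. *)
Lemma positive_sqrt_unique S M P T Z :
  adjoint S = S -> bounded_op S -> bicommutant Z S ->
  adjoint M = M -> bounded_op M -> bicommutant Z M ->
  (S * S) * (S * S) = Z -> (S * S) * M = 1 ->
  adjoint P = P -> P * P = P -> P * Z = Z * P -> bounded_op P ->
  T * P = T -> (adjoint T * T) * (adjoint T * T) = Z * P ->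
  adjoint T * T = S * S * P.
Proof.
move=> saS bS ZS saM bM ZM SZ NM saP PP PZ bP TP TT.
have [N NE] : exists N, S * S = N by exists (S * S).
rewrite NE in SZ NM *; set b := adjoint T * T in TT *.
have sab : adjoint b = b by rewrite adjointM adjointK.
have bPE : b * P = b by rewrite -mulrA TP.
have Pb : P * b = b by have := congr1 (@adjoint _ _ _ _) bPE; rewrite adjointM saP sab.
have bb : bounded_op b.
  by apply: bounded_op_square; rewrite sab TT -SZ -NE; do ?[apply: bounded_opM].
have bT : bounded_op T by apply: bounded_op_square.
have bZ : b * Z = Z * b.
  by rewrite -{1}bPE -mulrA PZ -TT mulrA TT -mulrA Pb.
have ZN : bicommutant Z N by rewrite -NE; apply: bicommutantM.
have MN : M * N = 1 by rewrite -[RHS]NM; apply: bicommutant_comm ZM ZN.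
have bM' := ZM _ bZ; have bS' := ZS _ bZ.
have PM' := ZM _ PZ; have PS' := ZS _ PZ; have PN' := ZN _ PZ.
have MS' := bicommutant_comm ZM ZS.
pose v := b * M.
have vN : v * N = b by rewrite -mulrA MN mulr1.
have vv : v * v = P.
  by rewrite comm_sqr // TT -PZ -SZ -!mulrA (mulrA N M M) NM mul1r NM mulr1.
have Pv : P * v = v by rewrite mulrA Pb.
have vP : v * P = v by rewrite -mulrA -PM' mulrA bPE.
have sav : adjoint v = v by apply: adjoint_comm.
pose e := 2^-1%:C *: (P - v).
have sae : adjoint e = e by rewrite adjointZr adjointB saP sav.
have be : bounded_op e.
  by apply: bounded_opZ; apply: bounded_opB => //; apply: bounded_opM.
have ve : v * e = - e.
  by rewrite /e -opscalerAr mulrBr vv vP -scalerN opprB.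
have ee : e * e = e.
  rewrite {1}/e -opscalerAl mulrBl ve opprK /e -opscalerAr mulrBr PP Pv.
  by rewrite scaler_half.
have vM : v * M = M * v by rewrite [RHS]mulrA -bM'.
have vS : v * S = S * v by rewrite -mulrA MS' mulrA bS' -mulrA.
have eM : e * M = M * e.
  by rewrite -opscalerAl -opscalerAr mulrBl mulrBr PM' vM.
have eS : e * S = S * e.
  by rewrite -opscalerAl -opscalerAr mulrBl mulrBr PS' vS.
have e0 : e = 0.
  (* [X] is the inverse of S, so conjugation by X turns - e N into - e, the form that
     [negative_square_eq0] takes. *)
  pose X := S * M; have eX : e * X = X * e by rewrite mulrA eS -!mulrA eM.
  have saX : adjoint X = X by apply: adjoint_comm.
  have eN : e * N = N * e by rewrite -NE mulrA eS -mulrA eS mulrA.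
  have be' : b * e = - (e * N) by rewrite -{1}vN -mulrA -eN mulrA ve mulNr.
  have XNX : X * (N * X) = 1.
    by rewrite /X -MS' (mulrA N) NM mul1r -mulrA NE MN.
  have bX : bounded_op X by apply: bounded_opM.
  clearbody X; apply: (@negative_square_eq0 _ _ _ (T * e * X)) => //.
  - by do ?[apply: bounded_opM].
  - by rewrite -[LHS]mulrA -eX [LHS]mulrA -[T * e * e]mulrA ee.
  - rewrite !adjointM saX sae -!mulrA (mulrA (adjoint T)) -/b (mulrA b) be'.
    by rewrite mulNr !mulrN -mulrA (mulrA e) ee mulrA -eX -mulrA XNX mulr1.
have Pv0 : P - v = 0 by rewrite -[LHS]scaler_half -/e e0 addr0.
by rewrite -vN -(subr0_eq Pv0) PN'.
Qed.

End PositiveRoot.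

(** * The matched projection *)

Section Idempotent.
Context {R : realType} {A : cstarAlgType R} {H : hilbertModType A}.
Variable Q : 'L(H).
Hypotheses (idemQ : Q * Q = Q) (bQ : bounded_op Q).

Definition sym_part := Q + adjoint Q - 1.
Local Notation F := sym_part.

Let idemQa : adjoint Q * adjoint Q = adjoint Q.
Proof. by rewrite -adjointM idemQ. Qed.

Lemma adjoint_sym_part : adjoint F = F.
Proof. by rewrite adjointB adjointD adjointK adjoint1 (addrC (adjoint Q)). Qed.

Lemma sym_part_sqr :
  F * F = 1 - Q - adjoint Q + Q * adjoint Q + adjoint Q * Q.
Proof.
transitivity (Q * Q + adjoint Q * adjoint Q + 1 - (Q + Q)
  - (adjoint Q + adjoint Q) + Q * adjoint Q + adjoint Q * Q).
  by rewrite /F; ncring.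
by rewrite idemQ idemQa; ncring.
Qed.

Lemma sym_part_sqr_comm : Q * (F * F) = (F * F) * Q.
Proof.
rewrite sym_part_sqr; transitivity (Q - Q * Q + (Q * Q) * adjoint Q
  - Q * adjoint Q + Q * adjoint Q * Q); first by ncring.
rewrite idemQ; transitivity (Q - Q * Q + adjoint Q * (Q * Q)
  - adjoint Q * Q + Q * adjoint Q * Q); last by ncring.
by rewrite idemQ; ncring.
Qed.

Lemma sym_part_sqr_comm_adjoint : adjoint Q * (F * F) = (F * F) * adjoint Q.
Proof.
have := congr1 (@adjoint _ _ _ _) sym_part_sqr_comm.
by rewrite !adjointM adjoint_sym_part.
Qed.

(** F^2 = 1 + K^2 with K = i (Q - [adjoint Q]) self-adjoint. Thus [S * S] is (F^2)^(1/2) and [M] its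
    inverse. *)
Lemma idempotent_calculus : exists S M,
  [/\ [/\ adjoint S = S, bounded_op S & bicommutant (F * F) S],
   [/\ adjoint M = M, bounded_op M & bicommutant (F * F) M],
   (S * S) * (S * S) = F * F & (S * S) * M = 1].
Proof.
pose K := 'i%C *: (Q - adjoint Q).
have saK : adjoint K = K.
  have ci : conjc 'i%C = - 'i%C :> R[i] by simpc.
  by rewrite adjointZ ci adjointB adjointK scaleNr -scalerN opprB.
have bK : bounded_op K.
  by apply/bounded_opZ/bounded_opB => //; apply: bounded_op_adjoint.
have KK : 1 + K * K = F * F.
  rewrite opscalerM -expr2 sqr_i scaleN1r sym_part_sqr.
  transitivity (1 - Q * Q - adjoint Q * adjoint Q + Q * adjoint Q + adjoint Q * Q).
    by ncring.
  by rewrite idemQ idemQa.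
have cK T : bicommutant (K * K) T -> bicommutant (F * F) T.
  move=> KT G GF; apply: KT; move: GF.
  by rewrite -KK mulrDr mulrDl mulr1 mul1r => /addrI.
have [S [G [[saS cS bS] [saG cG bG] SE GE]]] := sqrt_one_plus_square saK bK.
exists S, (S * S * G); split.
- by split=> //; apply: cK.
- split; [|by do ?[apply: bounded_opM]|].
    2: by apply/bicommutantM/cK/cG/bicommutantM; apply: cK.
  apply: adjoint_comm => //; first by rewrite adjointM saS.
  by apply: bicommutant_comm cG; apply: bicommutantM.
- by rewrite SE.
- by rewrite mulrA SE.
Qed.

Variables S M : 'L(H).
Hypotheses (saS : adjoint S = S) (bS : bounded_op S)
  (FS : bicommutant (F * F) S) (saM : adjoint M = M) (bM : bounded_op M)
  (FM : bicommutant (F * F) M) (SE : (S * S) * (S * S) = F * F)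
  (ME : (S * S) * M = 1).

Lemma sym_part_sqr_inv : (F * F) * (M * M) = 1.
Proof.
by rewrite -SE -!mulrA (mulrA S S (M * M)) (mulrA (S * S)) ME mul1r mulrA ME.
Qed.

(** The classical formula Q F^(-1) for the range projection, rewritten with Q F = [Q * adjoint Q] so
    that only the inverse of F^2 occurs. *)
Definition range_proj := Q * adjoint Q * (M * M).
Local Notation p := range_proj.

Let QM : Q * M = M * Q. Proof. exact/FM/sym_part_sqr_comm. Qed.
Let QaM : adjoint Q * M = M * adjoint Q.
Proof. exact/FM/sym_part_sqr_comm_adjoint. Qed.
Let QMM : Q * (M * M) = M * M * Q. Proof. by rewrite mulrA QM -mulrA QM mulrA. Qed.
Let QaMM : adjoint Q * (M * M) = M * M * adjoint Q.
Proof. by rewrite mulrA QaM -mulrA QaM mulrA. Qed.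
Let QQaQ : Q * adjoint Q * Q = Q * (F * F).
Proof.
rewrite sym_part_sqr; transitivity (Q - Q * Q + (Q * Q) * adjoint Q
  - Q * adjoint Q + Q * adjoint Q * Q); last by ncring.
by rewrite idemQ; ncring.
Qed.

Lemma range_projQ : p * Q = Q.
Proof.
by rewrite /p -mulrA -QMM mulrA QQaQ -mulrA sym_part_sqr_inv mulr1.
Qed.

Lemma Q_range_proj : Q * p = p.
Proof. by rewrite /p !mulrA idemQ. Qed.

Lemma adjoint_range_proj : adjoint p = p.
Proof.
by rewrite !adjointM !adjointK saM mulrA -QMM -mulrA -QaMM mulrA.
Qed.

Lemma range_proj_idem : p * p = p.
Proof. by rewrite {2}/p !mulrA range_projQ -mulrA. Qed.

Lemma is_projection_range_proj : is_projection p.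
Proof. by split; [apply: range_proj_idem|apply: adjoint_range_proj]. Qed.

Lemma adjointQ_range_proj : adjoint Q * p = adjoint Q.
Proof. by rewrite -{2}range_projQ adjointM adjoint_range_proj. Qed.

Lemma range_proj_adjointQ : p * adjoint Q = p.
Proof.
rewrite -[RHS]adjoint_range_proj -{2}Q_range_proj adjointM.
by rewrite adjoint_range_proj.
Qed.

Lemma range_range_proj : range p = range Q.
Proof.
apply/seteqP; split=> _ [x _ <-].
  by exists (p x) => //; rewrite -[LHS]/((Q * p) x) Q_range_proj.
by exists (Q x) => //; rewrite -[LHS]/((p * Q) x) range_projQ.
Qed.

Lemma range_projectionE : range_projection Q = p.
Proof.
apply: xget_unique.
  by split; [apply: is_projection_range_proj|apply: range_range_proj].
move=> p' [[idp' sap'] rp'].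
have pp' : p * p' = p'.
  apply: adjointable_ext => x; rewrite -[LHS]/(p (p' x)).
  have : range p (p' x) by rewrite range_range_proj -rp'; exists x.
  by case=> y _ <-; rewrite -[LHS]/((p * p) y) range_proj_idem.
have p'p : p' * p = p.
  apply: adjointable_ext => x; rewrite -[LHS]/(p' (p x)).
  have : range p' (p x) by rewrite rp' -range_range_proj; exists x.
  by case=> y _ <-; rewrite -[LHS]/((p' * p') y) idp'.
by rewrite -sap' -pp' adjointM sap' adjoint_range_proj.
Qed.

Lemma range_proj_comm : p * (F * F) = (F * F) * p.
Proof.
have MF : M * (F * F) = F * F * M by rewrite -FM.
have MMF : M * M * (F * F) = F * F * (M * M).
  by rewrite -mulrA MF mulrA MF mulrA.
rewrite /p -mulrA MMF !mulrA; congr (_ * M * M).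
rewrite -!mulrA (mulrA F F) sym_part_sqr_comm_adjoint.
by rewrite !mulrA -(mulrA Q F F) sym_part_sqr_comm.
Qed.

Lemma range_proj_sym_part : F * F * p = Q * adjoint Q.
Proof.
have MFF : M * M * (F * F) = 1.
  by rewrite -[RHS]sym_part_sqr_inv; apply: bicommutant_comm (bicommutantM FM FM) _.
by rewrite -range_proj_comm /p -mulrA MFF mulr1.
Qed.

Lemma bounded_range_proj : bounded_op p.
Proof. by do ?[apply: bounded_opM => //]; apply: bounded_op_adjoint. Qed.

(** [adjoint V * F = F * V] makes T = W V self-adjoint, and F V + V F = 2 F^2 gives T + T' = 2 S^2,
    the form of positivity that [bounded_by_sub1] takes. *)
Lemma bounded_by_matched_sub c : 1 <= c -> bounded_by (Q + Q - 1) c ->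
  bounded_by (1 + F * M - (Q + Q)) (c - 1).
Proof.
move=> c1; set V := Q + Q - 1 => Vc; pose W := F * M.
have FMc : F * M = M * F by apply: FM; rewrite mulrA.
have saW : adjoint W = W by apply: adjoint_comm => //; apply: adjoint_sym_part.
have WW : W * W = 1 by rewrite comm_sqr // sym_part_sqr_inv.
have VV : V * V = 1.
  transitivity (Q * Q + Q * Q + Q * Q + Q * Q - (Q + Q + Q + Q) + 1).
    by rewrite /V; ncring.
  by rewrite idemQ; ncring.
have VaF : adjoint V * F = F * V.
  rewrite adjointB adjointD adjoint1.
  transitivity (adjoint Q * Q + adjoint Q * Q - F).
    transitivity (adjoint Q * adjoint Q + adjoint Q * adjoint Q
      - adjoint Q - adjoint Q + adjoint Q * Q + adjoint Q * Q - F).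
      by rewrite /F; ncring.
    by rewrite idemQa; ncring.
  transitivity (Q * Q + Q * Q - Q - Q + adjoint Q * Q + adjoint Q * Q - F).
    by rewrite idemQ; ncring.
  by rewrite /F /V; ncring.
have FV : F * V + V * F = F * F + F * F.
  rewrite sym_part_sqr -VaF adjointB adjointD adjoint1.
  transitivity (Q * Q + Q * Q + adjoint Q * adjoint Q + adjoint Q * adjoint Q
    + adjoint Q * Q + Q * adjoint Q + adjoint Q * Q + Q * adjoint Q
    - Q - Q - Q - adjoint Q - adjoint Q - adjoint Q + 1 + 1
    - Q - adjoint Q); first by rewrite /F /V; ncring.
  by rewrite idemQ idemQa; ncring.
have VM : V * M = M * V by rewrite mulrBl mulrBr mulrDl mulrDr QM mul1r mulr1.
pose T := W * V; pose T' := V * W.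
have saT : adjoint T = T.
  by rewrite adjointM saW /W mulrA VaF -mulrA VM mulrA.
have TT' : T * T' = 1 by rewrite /T mulrA -(mulrA W V V) VV mulr1.
have T'T : T' * T = 1 by rewrite /T mulrA -(mulrA V W W) WW mulr1.
have TN : T + T' = S * S + S * S.
  rewrite /T /T' /W -mulrA -VM !mulrA -mulrDl FV mulrDl -SE -mulrA ME mulr1.
  by [].
(* What commutes with T commutes with T', hence with S^2 = (T + T')/2, hence with F^2 = S^4, hence
   with S. *)
have TS : bicommutant T S.
  move=> G GT; have GT' := bicommutant_inverse TT' T'T GT.
  have GN : G * (S * S) = S * S * G.
    rewrite -[S * S]scaler_half -scalerDr -TN -opscalerAr -opscalerAl.
    by rewrite mulrDr mulrDl GT GT'.
  by apply: FS; rewrite -SE mulrA GN -mulrA GN mulrA.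
have Wiso x : rnorm (W x) = rnorm x by apply: rnorm_isometry; rewrite saW.
have Tc : bounded_by T c by move=> x; rewrite Wiso.
have T'c : bounded_by T' c by move=> x; rewrite -(Wiso x); apply: Vc.
have -> : 1 + W - (Q + Q) = W * (1 - T).
  by rewrite mulrBr mulr1 /T mulrA WW mul1r /V; ncring.
move=> x; rewrite Wiso; apply/ler_addgt0Pr => e e0.
have x1 : 0 < rnorm x + 1 by have := rnorm_ge0 x; lra.
(* The excess (d - c) |x| stays below e; adding 1 covers x = 0. *)
pose d := c + e / (rnorm x + 1).
have cd : c < d by rewrite ltrDl divr_gt0.
apply: le_trans (bounded_by_sub1 c1 cd saT TT' T'T saS bS TS TN Tc T'c x) _.
rewrite /d addrAC mulrDl lerD2l mulrAC ler_pdivrMr // ler_pM2l //.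
by lra.
Qed.

End Idempotent.

(** * Evaluation of the block matrix *)

Section Corestriction.
Context {R : realType} {A : cstarAlgType R}.

Lemma corestrictP (E' E : innerProductModType A) (V : submodule E)
    (T : 'L(E', E)) (f : E' -> E) : f =1 T -> (forall x, carrier V (T x)) ->
  (forall x, inclusion (corestrict V f x) = T x) /\
  (forall y, adjoint (corestrict V f) y = adjoint T (inclusion y)).
Proof.
move=> fT VT.
have VT' x : T x \in in_submodule V by apply/asboolP/VT.
have adjT x y : inner (InSubmodule (VT' x)) y = inner x (adjoint T (inclusion y)) :> A.
  exact: opadjP.
have TS : forall x, inclusion (Adjointable adjT x) = f x by move=> x; rewrite fT.
have cT : corestrict V f = Adjointable adjT.
  apply: xget_unique => // S Sf; apply: adjointable_ext => x.
  by apply: val_inj; rewrite /= Sf fT.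
by rewrite cT; split.
Qed.

Lemma op_invE (E : innerProductModType A) (S T : 'L(E)) :
  S * T = 1 -> T * S = 1 -> op_inv T = S.
Proof.
move=> ST TS; apply: xget_unique => // S' [S'T TS'].
by rewrite -[S']mulr1 -TS mulrA S'T mul1r.
Qed.

End Corestriction.

Section MatchedProjectionFormula.
Context {R : realType} {A : cstarAlgType R} {H : hilbertModType A}.
Variable Q S M : 'L(H).
Local Notation F := (sym_part Q).
Local Notation p := (range_proj Q M).
Hypotheses (idemQ : Q * Q = Q) (bQ : bounded_op Q)
  (saS : adjoint S = S) (bS : bounded_op S)
  (FS : bicommutant (F * F) S) (saM : adjoint M = M) (bM : bounded_op M)
  (FM : bicommutant (F * F) M) (SE : (S * S) * (S * S) = F * F)
  (ME : (S * S) * M = 1).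

Let pE : range_projection Q = p. Proof. exact: range_projectionE FM SE ME. Qed.
Let pp : p * p = p. Proof. exact: range_proj_idem FM SE ME. Qed.
Let sap : adjoint p = p. Proof. exact: adjoint_range_proj. Qed.
Let pQ : p * Q = Q. Proof. exact: range_projQ FM SE ME. Qed.
Let Qp : Q * p = p. Proof. exact: Q_range_proj. Qed.
Let Qap : adjoint Q * p = adjoint Q.
Proof. exact: (adjointQ_range_proj idemQ saM FM SE ME). Qed.
Let pQa : p * adjoint Q = p. Proof. exact: range_proj_adjointQ. Qed.
Let pF : p * (F * F) = F * F * p. Proof. exact: range_proj_comm. Qed.

Local Notation RQ := (op_range Q).
Local Notation NQ := (op_kernel (adjoint Q)).
Local Notation U1 := (matchedU1 Q).
Local Notation U2 := (matchedU2 Q).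
Local Notation I1 := (adjoint (matchedU1 Q)).
Local Notation I2 := (adjoint (matchedU2 Q)).

Lemma range_proj_carrier x : carrier RQ (p x).
Proof. by exists (p x) => //; rewrite -[LHS]/((Q * p) x) Qp. Qed.

Lemma matchedU1P : (forall x, inclusion (U1 x) = p x) /\ I1 =1 @inclusion _ _ _ RQ.
Proof.
have [e1 e2] := @corestrictP _ _ _ _ RQ p (fun h => range_projection Q h)
  (fun h => congr1 (fun T : 'L(H) => T h) pE) range_proj_carrier.
split=> // y; rewrite e2 sap.
have /asboolP[x _ <-] := inclusionP y.
by rewrite -[LHS]/((p * Q) x) pQ.
Qed.

Lemma matchedU2P :
  (forall x, inclusion (U2 x) = (1 - p) x) /\ I2 =1 @inclusion _ _ _ NQ.
Proof.
have [] := @corestrictP _ _ _ _ NQ (1 - p) (fun h => (1 - range_projection Q) h).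
- by move=> x; rewrite pE.
- by move=> x; rewrite /= -[LHS]/((adjoint Q * (1 - p)) x) mulrBr mulr1 Qap subrr.
move=> e1 e2; split=> // y; rewrite e2 adjointB adjoint1 sap /=.
have /asboolP y0 : `[< adjoint Q (inclusion y) = 0 >] := inclusionP y.
rewrite -[LHS]/(inclusion y - p (inclusion y)) -pQa.
by rewrite -[X in _ - X]/(p (adjoint Q (inclusion y))) y0 opfun0 subr0.
Qed.

Lemma matchedAP : (forall x, inclusion (matchedA Q x) = (Q - p) (inclusion x)) /\
  (forall y, adjoint (matchedA Q) y = U2 ((adjoint Q - p) (inclusion y))).
Proof.
have [] := @corestrictP _ _ _ _ RQ ((Q - p) \oA I2)
  (fun x => (Q - range_projection Q) (inclusion x)).
- by move=> x; rewrite pE -[RHS]/((Q - p) (I2 x)) (proj2 matchedU2P).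
- move=> x; exists ((1 - p) (I2 x)) => //.
  by rewrite -[LHS]/((Q * (1 - p)) (I2 x)) mulrBr mulr1 Qp.
move=> e1 e2; split=> x; first by rewrite e1 -(proj2 matchedU2P).
rewrite e2 -[RHS]/((U2 \oA (adjoint Q - p)) _).
by rewrite -[X in adjoint Q - X]sap -adjointB.
Qed.

Lemma range_proj_inclusion (y : RQ) : p (inclusion y) = inclusion y.
Proof.
have /asboolP[x _ <-] := inclusionP y.
by rewrite -[LHS]/((p * Q) x) pQ.
Qed.

Lemma matchedU1K : cancel (@inclusion _ _ _ RQ) U1.
Proof.
move=> y; apply: val_inj.
by rewrite [LHS](proj1 matchedU1P) range_proj_inclusion.
Qed.

(** The corner p T p as an operator on the range. It is multiplicative as soon as the left factor
    commutes with p, which covers every function of F^2. *)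
Definition compress (T : 'L(H)) : 'L(RQ) := U1 \oA T \oA I1.

Lemma compressE T y : inclusion (compress T y) = p (T (inclusion y)).
Proof.
rewrite -[compress T y]/(U1 (T (I1 y))).
by rewrite (proj2 matchedU1P) (proj1 matchedU1P).
Qed.

Lemma compress1 : compress 1 = 1.
Proof.
apply: adjointable_ext => y; apply: val_inj.
by rewrite [LHS]compressE range_proj_inclusion.
Qed.

Lemma compressD T T' : compress (T + T') = compress T + compress T'.
Proof. by apply: adjointable_ext => y; rewrite /= opfunD. Qed.

Lemma compressM T T' : p * T = T * p -> compress T * compress T' = compress (T * T').
Proof.
move=> pT; apply: adjointable_ext => y; apply: val_inj.
rewrite -[LHS]/(inclusion (compress T (compress T' y))) !compressE.
rewrite -[LHS]/((p * T * p * T') (inclusion y)) -[p * T * p]mulrA -pT mulrA pp.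
by rewrite -mulrA [RHS]compressE.
Qed.

Lemma adjoint_compress T : adjoint (compress T) = compress (adjoint T).
Proof. exact: adjointable_ext. Qed.

Let pS : p * S = S * p. Proof. exact: FS. Qed.
Let pM : p * M = M * p. Proof. exact: FM. Qed.
Let pSS : p * (S * S) = S * S * p. Proof. by rewrite mulrA pS -mulrA pS mulrA. Qed.

(** (Q - p)(1 - p)([adjoint Q] - p) = [Q * adjoint Q] - p, and [Q * adjoint Q] = F^2 p. *)
Lemma matchedA_sqr : matchedA Q \oA adjoint (matchedA Q) + 1 = compress (F * F).
Proof.
apply: adjointable_ext => y; apply: val_inj; rewrite [RHS]compressE.
rewrite -[LHS]/(inclusion (matchedA Q (adjoint (matchedA Q) y)) + inclusion y).
rewrite (proj1 matchedAP) (proj2 matchedAP) (proj1 matchedU2P).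
rewrite -[RHS]/((p * (F * F)) _) pF (range_proj_sym_part idemQ FM SE ME).
rewrite -[X in X + _]/(((Q - p) * (1 - p) * (adjoint Q - p)) (inclusion y)).
have -> : (Q - p) * (1 - p) * (adjoint Q - p) = Q * adjoint Q - p.
  transitivity (Q * adjoint Q - Q * p - Q * p * adjoint Q + Q * (p * p) - p * adjoint Q
    + p * p + p * p * adjoint Q - p * p * p); first by ncring.
  by rewrite !pp !Qp !pQa; ncring.
by rewrite -[LHS]/(_ - p (inclusion y) + inclusion y) range_proj_inclusion subrK.
Qed.

(** The uniqueness of positive roots is established on H, so a competing factor [T] on the range is
    first extended by zero to [t] on H. *)
Lemma matchedBE : matchedB Q = compress (S * S).
Proof.
rewrite /matchedB matchedA_sqr; apply: xget_unique => [|B [[T BT] BB]].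
  split; last by rewrite compressM // SE.
  by exists (compress S); rewrite adjoint_compress saS compressM.
pose t : 'L(H) := I1 \oA T \oA U1.
have ext_t x : (adjoint t * t) x = inclusion (B (U1 x)).
  rewrite BT -[LHS]/(I1 (adjoint T (U1 (I1 (T (U1 x)))))).
  by rewrite !(proj2 matchedU1P) matchedU1K.
have tE : adjoint t * t = S * S * p.
  apply: (positive_sqrt_unique saS bS FS saM bM FM SE ME) => //.
  - exact: bounded_range_proj.
  - apply: adjointable_ext => x; rewrite -[LHS]/(I1 (T (U1 (p x)))).
    by rewrite -(proj1 matchedU1P) matchedU1K.
  apply: adjointable_ext => x; rewrite -[LHS]/((adjoint t * t) ((adjoint t * t) x)).
  rewrite !ext_t matchedU1K -[B (B _)]/((B * B) (U1 x)) BB compressE.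
  by rewrite (proj1 matchedU1P) -[LHS]/((p * (F * F) * p) x) pF -mulrA pp.
apply: adjointable_ext => y; apply: val_inj; rewrite [RHS]compressE.
rewrite -[in LHS](matchedU1K y) -[LHS]ext_t tE.
by rewrite -[LHS]/(S (S (p (inclusion y)))) range_proj_inclusion
  -[RHS]/((p * (S * S)) _) pSS -[RHS]/(S (S (p _))) range_proj_inclusion.
Qed.

Lemma matched_projectionE : ~ is_projection Q ->
  matched_projection Q = 2^-1 *: (1 + F * M).
Proof.
move=> nproj; rewrite /matched_projection asboolF //; congr (_ *: _).
(* Applied to [S] itself, this supplies [G] = (1 + S^2)^(-1), needed to invert B (B + 1). *)
have [_ [G [_ [_ NG _] _ GE]]] := sqrt_one_plus_square saS bS.
have SSc T : bicommutant (S * S) T -> bicommutant (F * F) T.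
  by move=> ST X XF; apply: ST; apply/bicommutantM/XF.
have pG : p * G = G * p by apply: NG.
have FSS : bicommutant (F * F) (S * S) by apply: bicommutantM.
have FG := SSc _ NG.
have FF1 : bicommutant (F * F) (1 + S * S).
  by apply: bicommutantD => //; apply: bicommutant1.
have invB : op_inv (matchedB Q) = compress M.
  rewrite matchedBE; apply: op_invE; rewrite compressM // -?compress1 ?ME //.
  by rewrite (bicommutant_comm FM FSS) ME.
have invBB : op_inv (matchedB Q * (matchedB Q + 1)) = compress (M * G).
  have -> : matchedB Q * (matchedB Q + 1) = compress (S * S * (1 + S * S)).
    by rewrite matchedBE -compress1 -compressD compressM // [1 + _]addrC.
  have E : S * S * (1 + S * S) * (M * G) = 1.
    rewrite (bicommutant_comm FM FG) -mulrA (mulrA (1 + _)) GE mul1r.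
    exact: ME.
  apply: op_invE; rewrite compressM -?compress1.
  - congr compress; rewrite -[RHS]E; apply: (@bicommutant_comm _ _ _ (F * F)).
      exact: bicommutantM.
    exact: bicommutantM.
  - by rewrite mulrA pM -mulrA pG mulrA.
  - by rewrite E.
  - exact: (bicommutantM FSS FF1) pF.
rewrite invB invBB matchedBE.
transitivity (p * (S * S) * p * M * p + p * M * p + p * M * (Q - p) * (1 - p)
  + ((1 - p) * (adjoint Q - p) * p * M * p
     + (1 - p) * (adjoint Q - p) * p * (M * G) * (Q - p) * (1 - p))).
  apply: adjointable_ext => x.
  rewrite -[LHS]/(I1 (compress (S * S) (compress M (U1 x)) + compress M (U1 x)
      + compress M (matchedA Q (U2 x)))
    + I2 (adjoint (matchedA Q) (compress M (U1 x))
      + adjoint (matchedA Q) (compress (M * G) (matchedA Q (U2 x))))).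
  have inclD (V : submodule H) (a b : V) :
    inclusion (a + b) = inclusion a + inclusion b by [].
  rewrite (proj2 matchedU1P) (proj2 matchedU2P) !inclD !(proj2 matchedAP).
  by rewrite !(compressE, proj1 matchedAP, proj1 matchedU1P, proj1 matchedU2P).
have Qp1 : (Q - p) * (1 - p) = Q - p by rewrite mulrBr mulr1 mulrBl Qp pp subrr subr0.
have pQp : p * (Q - p) = Q - p by rewrite mulrBr pQ pp.
have Qapp : (adjoint Q - p) * p = adjoint Q - p by rewrite mulrBl Qap pp.
have p1Qa : (1 - p) * (adjoint Q - p) = adjoint Q - p.
  by rewrite mulrBl mul1r mulrBr pQa pp subrr subr0.
have FQ := sym_part_sqr_comm idemQ; have FQa := sym_part_sqr_comm_adjoint idemQ.
have QpF : (Q - p) * (F * F) = F * F * (Q - p) by rewrite [LHS]mulrBl [RHS]mulrBr FQ pF.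
have QapF : (adjoint Q - p) * (F * F) = F * F * (adjoint Q - p).
  by rewrite [LHS]mulrBl [RHS]mulrBr FQa pF.
(* The factorization S^4 - 1 = (1 + S^2)(S^2 - 1) cancels [G]; with M S^2 = 1 the lower right block
   becomes (1 - M)(1 - p). *)
have QaQ : (adjoint Q - p) * (Q - p) = (1 + S * S) * ((S * S - 1) * (1 - p)).
  transitivity ((F * F - 1) * (1 - p)); last by rewrite -SE; ncring.
  rewrite [RHS]mulrBr mulr1 [(F * F - 1) * p]mulrBl mul1r.
  rewrite (range_proj_sym_part idemQ FM SE ME).
  rewrite sym_part_sqr // [LHS]mulrBl !mulrBr Qap pQ pp; ncring.
have -> : p * (S * S) * p * M * p = p.
  by rewrite -[p * (S * S) * p]mulrA -pSS mulrA pp -(mulrA p (S * S) M) ME mulr1 pp.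
have -> : p * M * p = p * M by rewrite -mulrA -pM mulrA pp.
have -> : p * M * (Q - p) * (1 - p) = (Q - p) * M.
  by rewrite -mulrA Qp1 pM -mulrA pQp FM.
rewrite p1Qa Qapp.
have -> : (adjoint Q - p) * M * p = (adjoint Q - p) * M.
  by rewrite -mulrA -pM mulrA Qapp.
have -> : (adjoint Q - p) * (M * G) * (Q - p) * (1 - p) = (1 - M) * (1 - p).
  rewrite -mulrA Qp1 (bicommutantM FM FG) // -mulrA QaQ -!mulrA (mulrA G).
  rewrite (bicommutant_comm FG FF1) GE mul1r mulrA; congr (_ * _).
  by rewrite mulrBr mulr1 (bicommutant_comm FM FSS) ME.
transitivity (1 + (Q + adjoint Q - 1) * M + (M * p - p * M)); first by ncring.
by rewrite pM subrr addr0.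
Qed.

End MatchedProjectionFormula.

(** * From pointwise bounds to the operator norm *)

Section OperatorNorm.
Context {R : realType} {A : cstarAlgType R} {H : hilbertModType A}.
Implicit Types (P Q T : 'L(H)) (d : R).

Lemma opnorm_ub T x : rnorm x <= 1 -> ((rnorm (T x))%:E <= opnorm T)%E.
Proof.
move=> x1; apply: ereal_sup_ubound; exists x => //=.
by rewrite -rnormE -(rmorph1 (real_complex R)) lecR.
Qed.

Lemma opnorm_ge0 T : (0 <= opnorm T)%E.
Proof. by have := @opnorm_ub T 0; rewrite opfun0 !rnorm0; apply. Qed.

Lemma opnorm_le T d : 0 <= d -> bounded_by T d -> (opnorm T <= d%:E)%E.
Proof.
move=> d0 Td; apply: ge_ereal_sup => _ [x /= x1 <-]; rewrite lee_fin.
move: x1; rewrite -rnormE -(rmorph1 (real_complex R)) lecR => x1.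
by rewrite (le_trans (Td x)) // ler_piMr.
Qed.

Lemma bounded_by_opnorm T d : opnorm T = d%:E -> bounded_by T d.
Proof.
move=> Td x; have [x0|x0] := eqVneq (rnorm x) 0.
  by rewrite x0 mulr0 (rnorm_eq0 x0) opfun0 rnorm0.
have {}x0 : 0 < rnorm x by rewrite lt_def x0 rnorm_ge0.
have := @opnorm_ub T ((rnorm x)^-1%:C *: x).
rewrite Td lee_fin opfunZ !rnormZ ger0_norm ?invr_ge0 ?rnorm_ge0 //.
by rewrite mulVf ?gt_eqF // => /(_ (lexx _)); rewrite mulrC ler_pdivrMr.
Qed.

Lemma projection_symmetry P : is_projection P ->
  adjoint (P + P - 1) * (P + P - 1) = 1.
Proof.
move=> [PP saP]; rewrite adjointB adjointD adjoint1 saP.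
transitivity (P * P + P * P + P * P + P * P - (P + P + P + P) + 1).
  by ncring.
by rewrite PP; ncring.
Qed.

(** Two cases are immediate: if Q is a projection the left side is 0, and if |P - Q| is infinite the
    right side is. Otherwise Q is bounded and the formula for m(Q) applies. *)
Lemma opnorm_matched_projection P Q : is_projection P -> is_idempotent Q ->
  (opnorm (matched_projection Q - Q)%R <= opnorm (P - Q)%R)%E.
Proof.
move=> projP idemQ.
have [projQ|nprojQ] := pselect (is_projection Q).
  rewrite /matched_projection asboolT // subrr.
  apply: le_trans (opnorm_ge0 _); apply: opnorm_le => // x.
  by rewrite mul0r rnorm0.
have := opnorm_ge0 (P - Q).
case E : (opnorm (P - Q)) => [d| |]; [|by move=> _; rewrite leey|by []].
rewrite lee_fin => d0; have PQd := bounded_by_opnorm E.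
have J1 : bounded_by (P + P - 1) 1.
  by move=> x; rewrite mul1r rnorm_isometry //; apply: projection_symmetry.
have Vd : bounded_by (Q + Q - 1) (1 + (d + d)).
  have -> : Q + Q - 1 = (P + P - 1) - ((P - Q) + (P - Q)) by ncring.
  exact: bounded_byD J1 (bounded_byN (bounded_byD PQd PQd)).
have bQ : bounded_op Q.
  rewrite -[Q]scaler_half -scalerDr; apply: bounded_opZ.
  rewrite -[Q + Q](subrK 1); apply: bounded_opD bounded_op1.
  by exists (1 + (d + d)) => //; lra.
have [S [M [[saS bS FS] [saM bM FM] SE ME]]] := idempotent_calculus idemQ bQ.
have c1 : 1 <= 1 + (d + d) by lra.
have := bounded_by_matched_sub idemQ saS bS FS saM FM SE ME c1 Vd.
have -> : 1 + (d + d) - 1 = d + d by lra.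
move=> mQ; apply: opnorm_le => // x.
have -> : matched_projection Q - Q = 2^-1%:C *: (1 + sym_part Q * M - (Q + Q)).
  rewrite (matched_projectionE idemQ bQ saS bS FS saM bM FM SE ME nprojQ).
  rewrite [RHS]scalerBr (scalerDr _ Q Q) scaler_half; congr (_ *: _ - _).
  by rewrite fmorphV rmorph_nat.
apply: le_trans (bounded_byZ _ mQ x) _.
by rewrite ger0_norm ?invr_ge0 //; have := rnorm_ge0 x; lra.
Qed.

End OperatorNorm.

Theorem theorem4p15 (R : realType) (A : cstarAlgType R) (H : hilbertModType A)
    (P Q : 'L(H)) (projP : is_projection P) (idemQ : is_idempotent Q) :
  (opnorm (matched_projection Q - Q)%R <= 2%:E * opnorm (P - Q)%R)%E /\
  (quasi_projection_pair P Q ->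
   (opnorm (matched_projection Q - Q)%R <= opnorm (P - Q)%R)%E).
Proof.
have mQ := opnorm_matched_projection projP idemQ.
split; last by [].
apply: le_trans mQ _.
rewrite -[leLHS]mul1e; apply: lee_wpmul2r; first exact: opnorm_ge0.
by rewrite lee_fin ler1n.
Qed.
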